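(* Let $\gamma$ be a smooth simple closed curve in the hyperbolic plane $H^2$, of length $L$, parameterized by arc length $s$, bounding a domain of area $A$, and let $k(s)$ be its geodesic curvature. Assume that $\gamma$ is horocyclically convex, that is, $k(s)>1$ for all $s$. Then there are at least four distinct points of $\gamma$ at which the geodesic curvature equals the average curvature of $\gamma$, that is, at which $$k(s)=\bar k,\qquad \bar k=\frac{1}{L}\int_0^L k(s)\,ds=\frac{2\pi+A}{L}.$$
   Context: $H^2$ is the hyperbolic plane of constant curvature $-1$. The geodesic curvature $k$ is taken with respect to the normal pointing into the domain bounded by the curve, so that it is positive for circles. Horocycles are the curves of constant curvature $1$; a curve is called horocyclically convex if its curvature is everywhere greater than $1$. The equality $\int_0^L k\,ds=2\pi+A$ is the Gauss-Bonnet formula. *)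

(* Defs.v *)
From HB Require Import structures.
From mathcomp Require Export all_boot all_order all_algebra.
From mathcomp Require Export all_classical all_reals all_analysis.
Export Order.TTheory GRing.Theory Num.Theory.
Export numFieldNormedType.Exports.

Set Implicit Arguments.
Unset Strict Implicit.
Unset Printing Implicit Defensive.

Local Open Scope classical_set_scope.
Local Open Scope ring_scope.

(* The hyperbolic plane is the upper half-plane {y > 0} with the metric
   (dx^2 + dy^2) / y^2, which has constant curvature -1. Points and tangent
   vectors are both written as pairs in R * R. *)
Section HyperbolicPlane.
Context {R : realType}.
Implicit Types (p v w : R * R) (D : set (R * R)).

Definition H2 : set (R * R) := [set p | 0 < p.2].

Definition hyp_metric p v w : R := (v.1 * w.1 + v.2 * w.2) / p.2 ^+ 2.

(* The Riemannian area element of the metric is dx dy / y^2. *)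
Definition hyp_area D : \bar R :=
  (\int[lebesgue_measure \x lebesgue_measure]_(p in D) (p.2 ^- 2)%:E)%E.

Definition smooth (f : R -> R) : Prop :=
  forall (n : nat) (t : R), derivable (derive1n n f) t 1.

Section Curves.
Implicit Types (gamma V : R -> R * R) (L s : R).

Definition velocity gamma s : R * R :=
  (derive1 (fst \o gamma) s, derive1 (snd \o gamma) s).

(* The L-periodic arc-length parameterization of a smooth simple closed curve
   in H2. Since the speed is 1, the length of the curve is L. *)
Definition simple_closed_curve gamma L : Prop :=
  [/\ 0 < L,
      smooth (fst \o gamma) /\ smooth (snd \o gamma),
      forall s, H2 (gamma s),
      forall s, hyp_metric (gamma s) (velocity gamma s) (velocity gamma s) = 1
    & (forall s, gamma (s + L) = gamma s) /\
      (forall s t, 0 <= s < L -> 0 <= t < L -> gamma s = gamma t -> s = t)].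

(* Compactness of the closure selects the inner one of the two components of
   the complement of the curve. For D open, closure D `\` D is the boundary
   of D. *)
Definition bounds_domain gamma D : Prop :=
  [/\ D `<=` H2, open D, connected D, compact (closure D)
    & closure D `\` D = range gamma].

(* Covariant derivative along gamma of the vector field V for the Levi-Civita
   connection. The nonzero Christoffel symbols of the metric are
   Gamma^x_xy = Gamma^x_yx = Gamma^y_yy = - 1 / y and Gamma^y_xx = 1 / y. *)
Definition cov_derive gamma V s : R * R :=
  let y := (gamma s).2 in
  let T := velocity gamma s in
  let v := V s in
  (derive1 (fst \o V) s - (T.1 * v.2 + T.2 * v.1) / y,
   derive1 (snd \o V) s + (T.1 * v.1 - T.2 * v.2) / y).

(* The metric is conformal to the Euclidean one, so the Euclidean rotation of
   the unit tangent vector by a right angle is a unit normal vector. *)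
Definition left_normal gamma s : R * R :=
  (- (velocity gamma s).2, (velocity gamma s).1).

Definition points_into p v D : Prop :=
  \forall e \near 0^'+, D (p.1 + e * v.1, p.2 + e * v.2).

(* When gamma bounds D, exactly one of the two unit normals at each point of
   gamma points into D. *)
Definition inner_normal gamma D s : R * R :=
  let n := left_normal gamma s in
  if `[< points_into (gamma s) n D >] then n else (- n.1, - n.2).

Definition geodesic_curvature gamma D s : R :=
  hyp_metric (gamma s) (cov_derive gamma (velocity gamma) s)
    (inner_normal gamma D s).

Definition mean_curvature gamma D L : R :=
  L^-1 * \int[lebesgue_measure]_(s in `[0, L]) geodesic_curvature gamma D s.

Definition horocyclically_convex gamma D : Prop :=
  forall s, 1 < geodesic_curvature gamma D s.

End Curves.
End HyperbolicPlane.

(* Main.v *)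
From mathcomp Require Import ring lra measurable_realfun.
Require Import Defs.

Set Implicit Arguments.
Unset Strict Implicit.
Unset Printing Implicit Defensive.
Local Open Scope classical_set_scope.
Local Open Scope ring_scope.

(** In the upper half-plane, let [th] be the Euclidean angle of the unit tangent
    vector of the curve, traversed with the inner side on its left. Then
    [x' = y cos th], [y' = y sin th] and [th' = k - cos th], so that [k > 1] makes
    [th] increasing: the curve is locally convex in the Euclidean sense.

    Gauss-Bonnet. A simple loop with increasing tangent angle turns exactly once
    ([rotation_number]): if it turned more, consecutive branches between leftmost
    and rightmost points, which are graphs over intervals and cannot cross, would
    form a spiral that never closes up. So the curve consists of one lower and one
    upper graph, a connectedness argument shows that the domain is the region
    between them ([domain_between]), and its area is the integral of [dx / y], that
    is of [cos th ds], along the curve ([loop_area]). Adding [2 pi], the integral of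
    [th'], gives the integral of [k = th' + cos th].

    Four points. In the hyperboloid model the unit tangent and normal vectors [T] and
    [N] satisfy [N' = - k T], and [T] is the derivative of the position. Hence, with
    [kappa] the average curvature, [k - kappa] is orthogonal to [1] and to the
    coordinates of [T] ([orthogonality]). The geodesic normal to the curve has two
    ideal end points; they move at rates proportional to [k - 1] and [k + 1], hence
    both in the same direction, and they turn once around the circle at infinity
    ([wedge_gt0]). For given times [s1] and [s2], the combination of [1] and of the
    coordinates of [T] which vanishes when the inner end is the one of time [s1], or
    the outer end the one of time [s2], therefore changes sign at [s1] and [s2] and
    nowhere else in a period. If [k - kappa] had fewer than four zeros, it would have
    no more than two sign changes, and one of these combinations would share them,
    which the orthogonality forbids ([four_points]). *)

(** * Calculus on the real line *)

Section DerivativeRules.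
Context {R : realType}.
Implicit Types (f g : R -> R) (a b c s : R).

Lemma is_derive_cont f s a : is_derive s 1 f a -> {for s, continuous f}.
Proof. by move=> [df _]; apply/differentiable_continuous/derivable1_diffP. Qed.

Lemma is_derive_unique f s a b : is_derive s 1 f a -> is_derive s 1 f b -> a = b.
Proof. by move=> [_ <-] [_ <-]. Qed.

Lemma dD f g s a b : is_derive s 1 f a -> is_derive s 1 g b ->
  is_derive s 1 (fun t => f t + g t) (a + b).
Proof. by move=> fa gb; exact: is_deriveD. Qed.

Lemma dN f s a : is_derive s 1 f a -> is_derive s 1 (fun t => - f t) (- a).
Proof. by move=> fa; exact: is_deriveN. Qed.

Lemma dM f g s a b : is_derive s 1 f a -> is_derive s 1 g b ->
  is_derive s 1 (fun t => f t * g t) (a * g s + f s * b).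
Proof.
move=> fa gb; apply: (is_derive_eq (is_deriveM fa gb)).
by rewrite /GRing.scale /=; ring.
Qed.

Lemma dC c s : is_derive s 1 (fun _ : R => c) 0.
Proof. exact: is_derive_cst. Qed.

Lemma dI s : is_derive s 1 (fun t : R => t) 1.
Proof. exact: is_derive_id. Qed.

Lemma dV f s a : f s != 0 -> is_derive s 1 f a ->
  is_derive s 1 (fun t => (f t)^-1) (- a / f s ^+ 2).
Proof.
move=> f0 fa; apply: (is_derive_eq (is_deriveV f0 fa)).
by rewrite /GRing.scale /=; field.
Qed.

Lemma dcomp f g s a b : is_derive (g s) 1 f a -> is_derive s 1 g b ->
  is_derive s 1 (fun t => f (g t)) (a * b).
Proof. exact: is_derive1_comp. Qed.

Lemma dcos f s a : is_derive s 1 f a ->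
  is_derive s 1 (fun t => cos (f t)) (- sin (f s) * a).
Proof. by move=> fa; apply: dcomp. Qed.

Lemma dsin f s a : is_derive s 1 f a ->
  is_derive s 1 (fun t => sin (f t)) (cos (f s) * a).
Proof. by move=> fa; apply: dcomp. Qed.

End DerivativeRules.

(* One rule per head symbol of the differentiated expression; the derivatives of
   the unknown functions come from the context. *)
Ltac derive_step := lazymatch goal with
  | |- is_derive _ _ (fun _ => ?c) _ => notypeclasses refine (dC c _)
  | |- is_derive _ _ (fun t => t) _ => notypeclasses refine (dI _)
  | |- is_derive _ _ (fun t => _ + _) _ => notypeclasses refine (dD _ _)
  | |- is_derive _ _ (fun t => - _) _ => notypeclasses refine (dN _)
  | |- is_derive _ _ (fun t => _ * _) _ => notypeclasses refine (dM _ _)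
  | |- is_derive _ _ (fun t => _^-1) _ => notypeclasses refine (dV _ _)
  | |- is_derive _ _ (fun t => cos _) _ => notypeclasses refine (dcos _)
  | |- is_derive _ _ (fun t => sin _) _ => notypeclasses refine (dsin _)
  | D : forall s, is_derive s _ ?f _ |- is_derive _ _ (fun t => ?f t) _ => exact: D
  | D : is_derive _ _ ?f _ |- is_derive _ _ (fun t => ?f t) _ => exact: D
  | D : forall s, is_derive s _ ?f _ |- is_derive _ _ ?f _ => exact: D
  | D : is_derive _ _ ?f _ |- is_derive _ _ ?f _ => exact: D
  end.

Section Monotonicity.
Context {R : realType}.
Implicit Types (f df : R -> R) (a b s t u v : R) (I : set R).

Lemma derive_itv_gt0_lt f df s t : s < t ->
  (forall u, s <= u <= t -> is_derive u 1 f (df u)) ->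
  (forall u, s < u < t -> 0 < df u) -> f s < f t.
Proof.
move=> st D pos.
have cf : {within `[s, t], continuous f}.
  apply: continuous_in_subspaceT => u; rewrite inE/= in_itv/= => uin.
  exact: is_derive_cont (D u uin).
have Do u : u \in `]s, t[ -> is_derive u 1 f (df u).
  by rewrite in_itv/= => /andP[su ut]; apply: D; rewrite !ltW.
have [v] := MVT st Do cf.
by rewrite in_itv /= => /pos vpos E; rewrite -subr_gt0 E mulr_gt0 ?subr_gt0.
Qed.

Lemma derive_gt0_lt f df a b : (forall s : R, is_derive s 1 f (df s)) ->
  a < b -> (forall s, a < s < b -> 0 < df s) -> f a < f b.
Proof. by move=> Df ab; exact: (derive_itv_gt0_lt ab (fun s _ => Df s)). Qed.

Lemma derive_gt0_le f df a b : (forall s : R, is_derive s 1 f (df s)) ->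
  a <= b -> (forall s, a < s < b -> 0 < df s) -> f a <= f b.
Proof.
move=> Df; rewrite le_eqVlt => /predU1P[->//|ab] pos.
exact: ltW (derive_gt0_lt Df ab pos).
Qed.

Lemma derive_eq0_cst f a b : (forall s : R, is_derive s 1 f 0) -> f a = f b.
Proof. exact: is_derive_0_is_cst. Qed.

Lemma ivt f a b v : continuous f -> a <= b ->
  (f a <= v <= f b) || (f b <= v <= f a) ->
  exists2 c, a <= c <= b & f c = v.
Proof.
move=> cf ab H.
have cfw : {within `[a, b], continuous f} by exact: continuous_subspaceT.
have [|c] := @IVT R f a b v ab cfw.
  rewrite ge_min le_max.
  by move: H => /orP[/andP[-> ->]|/andP[-> ->]]; rewrite ?orbT.
by rewrite in_itv /= => cab <-; exists c.
Qed.

Lemma pos_on_interval f I s : continuous f -> is_interval I ->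
  (forall u, I u -> f u != 0) -> I s -> 0 < f s -> forall u, I u -> 0 < f u.
Proof.
move=> cf iI nz Is fs u Iu; rewrite ltNge; apply/negP => fu.
have zero c : I c -> f c = 0 -> False by move=> /nz /eqP.
have [su|us] := leP s u.
  have [|c sc c0] := @ivt f s u 0 cf su; first by rewrite fu (ltW fs) orbT.
  exact: (zero c (iI _ _ Is Iu _ sc)).
have [|c sc c0] := @ivt f u s 0 cf (ltW us); first by rewrite fu (ltW fs).
exact: (zero c (iI _ _ Iu Is _ sc)).
Qed.

Lemma is_interval_cc a b : is_interval [set u | a <= u <= b].
Proof.
move=> u v /= /andP[au _] /andP[_ vb] w /andP[uw wv].
by rewrite (le_trans au uw) (le_trans wv vb).
Qed.

Lemma is_interval_oo a b : is_interval [set u | a < u < b].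
Proof.
move=> u v /= /andP[au _] /andP[_ vb] w /andP[uw wv].
by rewrite (lt_le_trans au uw) (le_lt_trans wv vb).
Qed.

Lemma continuous_inv_pos f : continuous f -> (forall u, 0 < f u) ->
  continuous (fun u => (f u)^-1).
Proof. by move=> cf f0 u; apply: cvgV; [rewrite gt_eqF | exact: cf]. Qed.

End Monotonicity.

Section Primitives.
Context {R : realType}.
Implicit Types (f F : R -> R) (a b c s t u : R).

Lemma ftc_closed F f a b : a < b -> continuous f -> continuous F ->
  (forall u : R, a < u < b -> is_derive u 1 F (f u)) ->
  (\int[lebesgue_measure]_(u in `[a, b]) (f u)%:E)%E = (F b - F a)%:E.
Proof.
move=> ab cf cF DF.
rewrite (@continuous_FTC2 _ f F a b ab); first by rewrite EFinB.
- exact: continuous_subspaceT.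
- split.
  + by move=> u; rewrite in_itv/= => /DF[].
  + exact: cvg_at_right_filter (cF a).
  + exact: cvg_at_left_filter (cF b).
- by move=> u; rewrite in_itv/= => /DF[_ <-]; rewrite derive1E.
Qed.

Lemma ftc_open F f a b : a < b -> continuous f -> continuous F ->
  (forall u : R, a < u < b -> is_derive u 1 F (f u)) ->
  (\int[lebesgue_measure]_(u in `]a, b[) (f u)%:E)%E = (F b - F a)%:E.
Proof.
move=> ab cf cF DF; rewrite -(ftc_closed ab cf cF DF).
have mf : measurable_fun setT (EFin \o f).
  by apply/measurable_EFinP; exact: continuous_measurable_fun.
rewrite integral_itv_bndo_bndc; last exact: measurable_funTS mf.
by rewrite integral_itv_obnd_cbnd; last exact: measurable_funTS mf.
Qed.

Lemma continuous_itv_integrable f a b : continuous f ->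
  lebesgue_measure.-integrable `[a, b] (EFin \o f).
Proof.
move=> cf; apply: continuous_compact_integrable; first exact: segment_compact.
exact: continuous_subspaceT.
Qed.

Lemma Rintegral_chasles f a b c : continuous f -> a <= b -> b <= c ->
  \int[lebesgue_measure]_(x in `[a, c]) f x =
  \int[lebesgue_measure]_(x in `[a, b]) f x
  + \int[lebesgue_measure]_(x in `[b, c]) f x.
Proof.
move=> cf ab bc.
have ibc := continuous_itv_integrable b c cf.
rewrite -(@Rintegral_itv_obnd_cbnd _ b (BRight c)); last first.
  apply: (integrableS _ _ _ ibc) => //.
  by apply: subset_itvr; rewrite bnd_simp.
rewrite -(@Rintegral_itvB _ f (BLeft a)) ?bnd_simp//; first by ring.
exact: continuous_itv_integrable.
Qed.

(** The fundamental theorem of calculus differentiates an integral with a fixed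
    lower end, and only beyond that end. On the whole line a primitive is the
    difference of the integrals up to [s] and up to [0], with a lower end far
    enough on the left, on which the difference does not depend. *)
Lemma antiderivative f : continuous f ->
  exists F, forall s : R, is_derive s 1 F (f s).
Proof.
move=> cf.
pose I n s := \int[lebesgue_measure]_(x in `[- n, s]) f x.
pose F s := I (`|s| + 1) s - I (`|s| + 1) 0.
have FE N s : `|s| + 1 <= N -> F s = I N s - I N 0.
  move=> sN; rewrite /F /I.
  have n0 : 0 <= `|s| by [].
  have sl : - `|s| <= s by apply: lerNnormlW.
  rewrite (@Rintegral_chasles f (- N) (- (`|s| + 1)) s) //; try lra.
  rewrite (@Rintegral_chasles f (- N) (- (`|s| + 1)) 0) //; try lra.
exists F => s.
pose N := `|s| + 2.
have n0 : 0 <= `|s| by [].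
have sl : - `|s| <= s by apply: lerNnormlW.
have su : s <= `|s| by exact: ler_norm.
have [||||dI1 dI2] := @continuous_FTC1 R f (BLeft (- N)) s (s + 1).
- lra.
- exact: continuous_itv_integrable.
- by rewrite lte_fin /N; lra.
- exact: cf.
have dIN : is_derive s 1 (I N) (f s).
  by apply: DeriveDef; [exact: dI1 | rewrite -derive1E; exact: dI2].
have dG : is_derive s 1 (fun t => I N t - I N 0) (f s).
  by eapply is_derive_eq; [repeat derive_step | rewrite addr0].
apply: near_eq_is_derive dG.
near=> t.
have H : `|t - s| < 1 by near: t; apply: cvgr_distC_lt => //; exact: cvg_id.
rewrite (FE N)// /N.
by have := ler_normD (t - s) s; rewrite subrK; lra.
Unshelve. all: end_near.
Qed.

End Primitives.

Section Periodicity.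
Context {R : realType}.

Lemma periodic_shift (T : Type) (f : R -> T) (L t0 s : R) : 0 < L ->
  (forall u, f (u + L) = f u) ->
  exists d, t0 <= s + d < t0 + L /\ forall u, f (u + d) = f u.
Proof.
move=> L0 fL.
have fn (n : nat) u : f (u + n%:R * L) = f u.
  elim: n => [|n IH]; first by rewrite mul0r addr0.
  by rewrite -[RHS]IH -[RHS]fL -natr1; congr f; ring.
pose m := Num.floor ((s - t0) / L).
have /andP[m1 m2] := Num.Theory.floor_itv ((s - t0) / L).
rewrite ler_pdivlMr// in m1; rewrite ltr_pdivrMr// intrD mulrDl mul1r in m2.
exists (- (m%:~R * L)); split; first by rewrite /m; apply/andP; split; lra.
case: m {m1 m2} => n u.
  by rewrite -[LHS](fn n) -pmulrn; congr f; rewrite subrK.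
by rewrite -[RHS](fn n.+1) NegzE mulrNz -pmulrn mulNr opprK.
Qed.

Lemma is_derive_shift (f : R -> R) (L s a : R) :
  is_derive (s + L) 1 f a -> is_derive s 1 (fun s => f (s + L)) a.
Proof.
move=> Df; have DL : is_derive s 1 (fun s => s + L) 1.
  by eapply is_derive_eq; [repeat derive_step | rewrite addr0].
by apply: (is_derive_eq (dcomp (g := fun s => s + L) Df DL)); rewrite mulr1.
Qed.

Lemma periodic_derive (f df : R -> R) (L : R) : (forall s : R, is_derive s 1 f (df s)) ->
  (forall s, f (s + L) = f s) -> forall s, df (s + L) = df s.
Proof.
move=> Df fL s; have DL := is_derive_shift (Df (s + L)).
have E : (fun s => f (s + L)) = f by apply/funext.
by rewrite E in DL; exact: is_derive_unique DL (Df s).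
Qed.

Lemma periodic_increment (f df : R -> R) (L : R) :
  (forall s : R, is_derive s 1 f (df s)) -> (forall s, df (s + L) = df s) ->
  forall s t, f (s + L) - f s = f (t + L) - f t.
Proof.
move=> Df dfL s t; apply: (@derive_eq0_cst _ (fun s => f (s + L) - f s)) => u.
apply: (is_derive_eq (dD (is_derive_shift (Df (u + L))) (dN (Df u)))).
by rewrite dfL subrr.
Qed.

End Periodicity.

Section Angles.
Context {R : realType}.

Lemma unit_angle (a b : R) : a ^+ 2 + b ^+ 2 = 1 -> exists t : R, cos t = a /\ sin t = b.
Proof.
move=> ab.
have a1 : -1 <= a <= 1 by apply/andP; split; nra.
have E : Num.sqrt (1 - a ^+ 2) = `|b| by rewrite -ab addrC addKr sqrtr_sqr.
have aK : cos (acos a) = a by apply: acosK; rewrite in_itv.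
have [b0|b0] := leP 0 b.
  by exists (acos a); rewrite sin_acos// E ger0_norm.
exists (- acos a); rewrite cosN sinN sin_acos// E ltr0_norm//.
by rewrite opprK.
Qed.

Lemma cos_eq1_mod2pi (v : R) : 0 <= v -> cos v = 1 -> exists n : nat, v = n%:R * (2 * pi).
Proof.
move=> v0 cv; have pi0 : 0 < pi :> R by exact: pi_gt0.
have p2 : 0 < 2 * pi :> R by lra.
pose n := Num.truncn (v / (2 * pi)).
have /andP[n1 n2] : n%:R <= v / (2 * pi) < n.+1%:R.
  by apply: truncn_itv; rewrite divr_ge0// ltW.
rewrite ler_pdivlMr// in n1; rewrite ltr_pdivrMr// -natr1 in n2.
exists n; apply/eqP; rewrite eq_le n1 andbT leNgt; apply/negP => lt.
set d := v - n%:R * (2 * pi).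
have cd : cos d = 1.
  have cn m : cos (m%:R * (2 * pi)) = 1 :> R /\ sin (m%:R * (2 * pi)) = 0 :> R.
    elim: m => [|m [IHc IHs]]; first by rewrite mul0r cos0 sin0.
    have -> : m.+1%:R * (2 * pi) = m%:R * (2 * pi) + pi + pi :> R.
      by rewrite -natr1; ring.
    by rewrite !cosDpi !sinDpi IHc IHs !opprK.
  by rewrite /d cosB (proj1 (cn n)) (proj2 (cn n)) cv; ring.
have s0 : 0 < sin (d / 2).
  by apply: sin_gt0_pi; rewrite /d; apply/andP; split; lra.
have : cos d = 1 - 2 * sin (d / 2) ^+ 2.
  have {1}-> : d = d / 2 + d / 2 by field.
  by rewrite cosD; have := cos2Dsin2 (d / 2); nra.
by rewrite cd; nra.
Qed.

(** The primitive of [c * dd - d * dc], with the right value at [0], is an angle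
    of the unit vector [(c, d)]: the scalar product of [(c, d)] with
    [(cos th, sin th)] is constant and starts at [1]. *)
Lemma angle_lift (c d dc dd : R -> R) :
  (forall s : R, is_derive s 1 c (dc s)) -> (forall s : R, is_derive s 1 d (dd s)) ->
  continuous dc -> continuous dd ->
  (forall s, c s ^+ 2 + d s ^+ 2 = 1) ->
  exists th : R -> R, forall s : R, [/\ c s = cos (th s), d s = sin (th s) &
    is_derive s 1 th (c s * dd s - d s * dc s)].
Proof.
move=> Dc Dd cdc cdd unit.
have cc : continuous c by move=> s; exact: is_derive_cont (Dc s).
have cd : continuous d by move=> s; exact: is_derive_cont (Dd s).
pose w s := c s * dd s - d s * dc s.
have [F DF] : exists F : R -> R, forall s : R, is_derive s 1 F (w s).
  apply: antiderivative => s; apply: (@cvgB R R^o).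
    exact: cvgM (cc s) (cdd s).
  exact: cvgM (cd s) (cdc s).
have [t0 [ct0 st0]] := unit_angle (unit 0).
pose th s := F s + (t0 - F 0).
have Dth (s : R) : is_derive s 1 th (w s).
  by rewrite /th; eapply is_derive_eq; [repeat derive_step | rewrite addr0].
have orth s : c s * dc s + d s * dd s = 0.
  have D1 : is_derive s 1 (fun s => c s * c s + d s * d s) (2 * (c s * dc s + d s * dd s)).
    by eapply is_derive_eq; [repeat derive_step | ring].
  have E : (fun s => c s * c s + d s * d s) = (fun=> 1).
    by apply/funext => u; rewrite -!expr2.
  rewrite E in D1; have := is_derive_unique D1 (dC 1 s); lra.
have DE (s : R) : is_derive s 1 (fun s => c s * cos (th s) + d s * sin (th s)) 0.
  eapply is_derive_eq; first by repeat derive_step.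
  have -> : dc s = - d s * w s.
    transitivity (dc s * (c s ^+ 2 + d s ^+ 2)); first by rewrite unit mulr1.
    transitivity (c s * (c s * dc s + d s * dd s) - d s * (c s * dd s - d s * dc s)).
      by ring.
    by rewrite orth /w; ring.
  have -> : dd s = c s * w s.
    transitivity (dd s * (c s ^+ 2 + d s ^+ 2)); first by rewrite unit mulr1.
    transitivity (d s * (c s * dc s + d s * dd s) + c s * (c s * dd s - d s * dc s)).
      by ring.
    by rewrite orth /w; ring.
  by ring.
exists th => s.
have E1 : c s * cos (th s) + d s * sin (th s) = 1.
  have th0 : th 0 = t0 by rewrite /th; ring.
  by rewrite (derive_eq0_cst s 0 DE) th0 ct0 st0 -!expr2.
have := unit s; have := cos2Dsin2 (th s); move: E1.
have := Dth s; move: (cos (th s)) (sin (th s)) => u v Ds E1 E2 E3.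
have E : (c s - u) ^+ 2 + (d s - v) ^+ 2 = 0 by move: E1 E2 E3; rewrite !expr2; nra.
have [e1 e2] : (c s - u) ^+ 2 = 0 /\ (d s - v) ^+ 2 = 0.
  by have := sqr_ge0 (c s - u); have := sqr_ge0 (d s - v); split; lra.
by split=> //; apply/subr0_eq/eqP; rewrite -sqrf_eq0 ?e1 ?e2.
Qed.

End Angles.

(** * Monotone arcs as graphs *)

Section Arcs.
Context {R : realType}.
Implicit Types (x sigma : R -> R) (a b s t w alpha beta : R).

(** [sigma] parameterizes by the abscissa the arc of times [alpha, beta], on which
    the abscissa [x] is a bijection onto [a, b]. It is continuous on the whole line,
    so that the functions built from it need no restriction to an interval. *)
Definition arc_inverse x alpha beta a b sigma : Prop :=
  [/\ continuous sigma,
      forall w, a <= w <= b -> alpha <= sigma w <= beta /\ x (sigma w) = w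
    & forall s, alpha <= s <= beta -> a <= x s <= b /\ sigma (x s) = s].

(** The inverse is composed with the projection onto [x alpha, x beta]. It is
    continuous because it is monotone without jumps: to stay below
    [sigma w0 + e] it is enough that the projection stays below
    [x (sigma w0 + e)]. *)
Lemma arc_inverse_incr x dx alpha beta : alpha < beta ->
  (forall s : R, is_derive s 1 x (dx s)) ->
  (forall s, alpha < s < beta -> 0 < dx s) ->
  exists sigma, arc_inverse x alpha beta (x alpha) (x beta) sigma.
Proof.
move=> ab Dx pos.
have cx : continuous x by move=> s; exact: is_derive_cont (Dx s).
have incr s t : alpha <= s -> s < t -> t <= beta -> x s < x t.
  move=> as_ st tb; apply: (derive_gt0_lt Dx st) => u /andP[su ut].
  by apply: pos; rewrite (le_lt_trans as_ su) (lt_le_trans ut tb).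
have incrR s t : alpha <= t -> s <= beta -> x s < x t -> s < t.
  move=> at_ sb xst; rewrite ltNge; apply/negP; rewrite le_eqVlt.
  by move=> /predU1P[E|/incr]; [rewrite E ltxx in xst | move=> /(_ at_ sb); lra].
have xab := incr alpha beta (lexx _) ab (lexx _).
pose cl w := Num.max (x alpha) (Num.min (x beta) w).
have clP w : x alpha <= cl w <= x beta.
  by rewrite /cl le_max lexx /= ge_max ge_min lexx (ltW xab).
have clE w : x alpha <= w <= x beta -> cl w = w.
  by move=> /andP[w1 w2]; rewrite /cl min_r// max_r.
have ccl : continuous cl.
  move=> w; apply: continuous_max; first exact: cvg_cst.
  by apply: continuous_min; [exact: cvg_cst | exact: cvg_id].
have /choice[sg sgP] w : exists s, alpha <= s <= beta /\ x s = cl w.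
  have [|s sab sw] := @ivt _ x alpha beta (cl w) cx (ltW ab); last by exists s.
  by rewrite clP.
have sgx s : alpha <= s <= beta -> x alpha <= x s <= x beta /\ sg (x s) = s.
  move=> /andP[s1 s2].
  have xs : x alpha <= x s <= x beta.
    apply/andP; split; apply: (derive_gt0_le Dx) => // u /andP[u1 u2]; apply: pos;
     apply/andP; split; lra.
  split=> //.
  have [/andP[g1 g2]] := sgP (x s); rewrite clE// => E.
  have [l|l|//] := ltgtP (sg (x s)) s.
    by have := incr _ _ g1 l s2; rewrite E ltxx.
  by have := incr _ _ s1 l g2; rewrite E ltxx.
exists sg; split=> //; last first.
  by move=> w wab; have [? ->] := sgP w; rewrite clE.
move=> w0.
suff : forall e : R, 0 < e -> \forall w \near w0, `|sg w0 - sg w| < e.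
  by move=> H; apply/(@cvgrPdist_lt _ R^o) => e e0; exact: H.
move=> e e0.
have [s01 s02] := sgP w0; have /andP[s0a s0b] := s01.
have up : \forall w \near w0, sg w < sg w0 + e.
  have [big|small] := ltP beta (sg w0 + e).
    by near=> w; have [/andP[_ +] _] := sgP w; lra.
  have lt0 : cl w0 < x (sg w0 + e) by rewrite -s02; apply: incr => //; lra.
  near=> w.
  have [/andP[w1 w2] wE] := sgP w.
  apply: incrR => //; first by lra.
  by rewrite wE; near: w; exact: (cvgr_lt _ (ccl w0)).
have lo : \forall w \near w0, sg w0 - e < sg w.
  have [big|small] := ltP (sg w0 - e) alpha.
    by near=> w; have [/andP[+ _] _] := sgP w; lra.
  have lt0 : x (sg w0 - e) < cl w0 by rewrite -s02; apply: incr => //; lra.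
  near=> w.
  have [/andP[w1 w2] wE] := sgP w.
  apply: incrR => //; first by lra.
  by rewrite wE; near: w; exact: (cvgr_gt _ (ccl w0)).
near=> w.
have h1 : sg w < sg w0 + e by near: w.
have h2 : sg w0 - e < sg w by near: w.
by rewrite ltr_norml; apply/andP; split; lra.
Unshelve. all: end_near.
Qed.

Lemma arc_inverse_opp x alpha beta a b sigma :
  arc_inverse x alpha beta a b sigma ->
  arc_inverse (fun s => - x s) alpha beta (- b) (- a) (fun w => sigma (- w)).
Proof.
move=> [cs s1 s2]; split.
- by move=> w; apply: continuous_comp; [exact: oppr_continuous | exact: cs].
- move=> w wab; have [|sab E] := s1 (- w); first by apply/andP; split; lra.
  by split=> //; rewrite E opprK.
- move=> s sab; have [xab E] := s2 s sab; rewrite opprK; split=> //.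
  by apply/andP; split; lra.
Qed.

Lemma arc_inverse_decr x dx alpha beta : alpha < beta ->
  (forall s : R, is_derive s 1 x (dx s)) ->
  (forall s, alpha < s < beta -> dx s < 0) ->
  exists sigma, arc_inverse x alpha beta (x beta) (x alpha) sigma.
Proof.
move=> ab Dx neg.
have DN s : is_derive s 1 (fun s => - x s) (- dx s) by exact: dN.
have [|sg sgP] := arc_inverse_incr ab DN.
  by move=> s sab; rewrite oppr_gt0 neg.
exists (fun w => sg (- w)); have := arc_inverse_opp sgP; rewrite /= !opprK.
by under eq_fun do rewrite opprK.
Qed.

Lemma derive_arc_inverse x dx alpha beta a b sigma s :
  (forall u : R, is_derive u 1 x (dx u)) -> arc_inverse x alpha beta a b sigma ->
  alpha < s < beta -> dx s != 0 -> is_derive (x s) 1 sigma (dx s)^-1.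
Proof.
move=> Dx [cs A B] /andP[s1 s2] d0.
apply: is_derive_inverse => //.
  near=> u; apply: (proj2 (B u _)).
  by apply/andP; split; apply: ltW; near: u; [exact: lt_nbhsr | exact: lt_nbhsl].
by near=> u; exact: is_derive_cont (Dx u).
Unshelve. all: end_near.
Qed.

End Arcs.

(** * The rotation number of a simple locally convex loop *)

(** A plane loop with tangent angle [th], speed [r] and positive turning speed [w].
    The angle gains [c] in each period [L]. Only the Euclidean structure matters
    here: this makes rotations available. *)
Record turning_loop {R : realType} (x y th r w : R -> R) (L c : R) : Prop :=
  TurningLoop {
    tl_period : 0 < L;
    tl_dx : forall s : R, is_derive s 1 x (r s * cos (th s));
    tl_dy : forall s : R, is_derive s 1 y (r s * sin (th s));
    tl_dth : forall s : R, is_derive s 1 th (w s);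
    tl_r : forall s, 0 < r s;
    tl_w : forall s, 0 < w s;
    tl_x : forall s, x (s + L) = x s;
    tl_y : forall s, y (s + L) = y s;
    tl_th : forall s, th (s + L) = th s + c;
    tl_simple : forall s t, s < t < s + L -> ~ (x s = x t /\ y s = y t) }.

Section Turning.
Context {R : realType}.
Implicit Types (x y th r w sigma : R -> R) (a b s t u p q L c phi : R).

Lemma turning_loop_opp x y th r w L c : turning_loop x y th r w L c ->
  turning_loop (fun s => - x s) (fun s => - y s) (fun s => th s + pi) r w L c.
Proof.
case=> L0 dx dy dth r0 w0 px py pth sim; split=> //.
- by move=> s; apply: (is_derive_eq (dN (dx s))); rewrite cosDpi; ring.
- by move=> s; apply: (is_derive_eq (dN (dy s))); rewrite sinDpi; ring.
- by move=> s; eapply is_derive_eq; [repeat derive_step | rewrite addr0].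
- by move=> s; rewrite px.
- by move=> s; rewrite py.
- by move=> s; rewrite pth; ring.
- by move=> s t st [/oppr_inj xE /oppr_inj yE]; apply: (sim s t st).
Qed.

Section Facts.
Context x y th r w L c (H : turning_loop x y th r w L c).

Lemma turning_y_cont : continuous y.
Proof. by move=> s; exact: is_derive_cont (tl_dy H s). Qed.
Lemma turning_th_cont : continuous th.
Proof. by move=> s; exact: is_derive_cont (tl_dth H s). Qed.

Lemma turning_th_lt s t : (th s < th t) = (s < t).
Proof.
have hlt u v : u < v -> th u < th v.
  by move=> uv; apply: (derive_gt0_lt (tl_dth H) uv) => ? _; exact: tl_w H _.
apply/idP/idP; last exact: hlt.
move=> h; rewrite ltNge; apply/negP; rewrite le_eqVlt => /predU1P[E|/hlt]; last lra.
by rewrite E ltxx in h.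
Qed.

Lemma turning_th_le s t : (th s <= th t) = (s <= t).
Proof. by rewrite leNgt turning_th_lt -leNgt. Qed.

Lemma turning_th_inj : injective th.
Proof.
move=> s t E; apply/eqP.
by rewrite eq_le -(turning_th_le s t) -(turning_th_le t s) E lexx.
Qed.

Lemma turning_c_gt0 : 0 < c.
Proof.
by have := turning_th_lt 0 (0 + L); rewrite (tl_th H) add0r (tl_period H); lra.
Qed.

(** The velocity is periodic, so the gain in angle is a multiple of [2 pi]. *)
Lemma turning_cos_c : cos c = 1.
Proof.
have := periodic_derive (tl_dx H) (tl_x H) 0.
have := periodic_derive (tl_dy H) (tl_y H) 0.
rewrite (tl_th H); move: (th 0) => t0; have := tl_r H (0 + L); have := tl_r H 0.
move: (r 0) (r (0 + L)) => r0 r1 p0 p1 E2 E1.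
have E : r1 = r0.
  have q : r1 ^+ 2 = r0 ^+ 2.
    have := cos2Dsin2 (t0 + c); have := cos2Dsin2 t0.
    move=> A B; rewrite -[r1 ^+ 2]mulr1 -B -[r0 ^+ 2]mulr1 -A !mulrDr -!exprMn E1 E2//.
  by apply/eqP; rewrite -(@eqrXn2 _ 2) ?ltW// q.
have n0 : r0 != 0 by rewrite gt_eqF.
rewrite E in E1 E2; move: E1 E2 => /(mulfI n0) E1 /(mulfI n0) E2.
have -> : c = (t0 + c) - t0 by ring.
by rewrite cosB E1 E2 -!expr2 cos2Dsin2.
Qed.

Lemma turning_shift s (n : nat) : x (s + n%:R * L) = x s /\
  y (s + n%:R * L) = y s /\ th (s + n%:R * L) = th s + n%:R * c.
Proof.
elim: n => [|n [IHx [IHy IHth]]]; first by rewrite !mul0r !addr0.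
have -> : s + n.+1%:R * L = s + n%:R * L + L by rewrite -natr1; ring.
rewrite (tl_x H) (tl_y H) (tl_th H) IHx IHy IHth; split=> //; split=> //.
by rewrite -natr1; ring.
Qed.

(** The tangent angle takes every value: it gains [c > 0] each period. *)
Lemma turning_th_surj v : exists s, th s = v.
Proof.
have c0 := turning_c_gt0.
pose n := (Num.truncn (`|v - th 0| / c)).+1.
have nP : `|v - th 0| < n%:R * c.
  by rewrite -ltr_pdivrMr//; exact: truncnS_gt.
have Lp := tl_period H.
have [_ [_ t1]] := turning_shift 0 n.
have [_ [_ t2]] := turning_shift (- (n%:R * L)) n.
rewrite add0r in t1; rewrite addNr in t2.
have nL : 0 <= n%:R * L by rewrite mulr_ge0 ?ltW.
have := ler_norm (v - th 0); have := ler_norm (- (v - th 0)); rewrite normrN => h1 h2.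
have [|||s _ sv] := @ivt _ th (- (n%:R * L)) (n%:R * L) v; last by exists s.
- exact: turning_th_cont.
- lra.
- by apply/orP; left; apply/andP; split; lra.
Qed.

Lemma turning_y_neq s1 s2 : s1 < s2 < s1 + L -> x s1 = x s2 -> y s2 - y s1 != 0.
Proof.
move=> st xE; apply/eqP => /subr0_eq yE.
by apply: (tl_simple H st).
Qed.

(** Two branches over the same interval never meet, so the higher one stays
    higher. *)
Lemma no_crossing sigma1 sigma2 p q : continuous sigma1 -> continuous sigma2 ->
  (forall u, p <= u <= q -> x (sigma1 u) = u /\ x (sigma2 u) = u /\
     sigma1 u < sigma2 u < sigma1 u + L) ->
  forall v u, p <= v <= q -> p <= u <= q ->
  (y (sigma1 v) < y (sigma2 v)) = (y (sigma1 u) < y (sigma2 u)).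
Proof.
move=> c1 c2 P.
have cy (s : R -> R) : continuous s -> continuous (fun u => y (s u)).
  by move=> cs u; apply: continuous_comp; [exact: cs|exact: turning_y_cont].
have cd : continuous (fun u => y (sigma2 u) - y (sigma1 u)).
  by move=> u; apply: (@continuousB R R^o); apply: cy.
have nz u : p <= u <= q -> y (sigma2 u) - y (sigma1 u) != 0.
  by move=> /P [x1 [x2 lt]]; apply: turning_y_neq => //; rewrite x1 x2.
have imp v u : p <= v <= q -> p <= u <= q ->
    y (sigma1 v) < y (sigma2 v) -> y (sigma1 u) < y (sigma2 u).
  move=> vpq upq; rewrite -subr_gt0 => h; rewrite -subr_gt0.
  exact: (pos_on_interval cd (@is_interval_cc _ p q) nz vpq h).
by move=> v u vpq upq; apply/idP/idP; exact: imp.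
Qed.

(** With [phi] the angle of the upward vertical, the abscissa increases during the
    half turn that precedes [phi] and decreases during the next one; the ordinate
    increases on the two quarter turns around [phi]. *)
Lemma turning_right phi : cos phi = 0 -> sin phi = 1 -> forall s,
  (- pi < th s - phi < 0 -> 0 < r s * cos (th s)) /\
  (0 < th s - phi < pi -> r s * cos (th s) < 0) /\
  (- (pi / 2) < th s - phi < pi / 2 -> 0 < r s * sin (th s)).
Proof.
move=> c0 s1 s; set d := th s - phi.
have thE : th s = phi + d by rewrite /d; ring.
have cE : cos (th s) = - sin d by rewrite thE cosD c0 s1; ring.
have sE : sin (th s) = cos d by rewrite thE sinD c0 s1; ring.
have r0 := tl_r H s.
rewrite cE sE; split; [|split].
- by move=> hd; rewrite mulr_gt0// -sinN sin_gt0_pi//; apply/andP; split; lra.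
- by move=> hd; rewrite mulrN oppr_lt0 mulr_gt0// sin_gt0_pi.
- by move=> hd; rewrite mulr_gt0// cos_gt0_pihalf.
Qed.

(** At a rightmost point the curve runs upwards, so just left of it the
    incoming branch lies below the outgoing one; as the two branches cannot
    meet again, this persists over their whole common range. *)
Lemma right_cap phi t0 t1 t2 sigma0 sigma1 :
  cos phi = 0 -> sin phi = 1 ->
  th t0 = phi - pi -> th t1 = phi -> th t2 = phi + pi ->
  arc_inverse x t0 t1 (x t0) (x t1) sigma0 ->
  arc_inverse x t1 t2 (x t2) (x t1) sigma1 ->
  forall u, x t0 <= u -> x t2 <= u -> u < x t1 ->
  t2 < t0 + L \/ (t2 = t0 + L /\ x t2 < u) ->
  y (sigma0 u) < y (sigma1 u).
Proof.
move=> c0 s1 E0 E1 E2 [cs0 A0 B0] [cs1 A1 B1] u u0 u2 u1 tL.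
have Dx := tl_dx H; have Dy := tl_dy H.
have pi0 : 0 < pi :> R by exact: pi_gt0.
have TR := turning_right c0 s1.
have [m0 M0] := turning_th_surj (phi - pi / 2).
have [m1 M1] := turning_th_surj (phi + pi / 2).
have tlt := turning_th_lt; have tle := turning_th_le.
have t0m0 : t0 < m0 by rewrite -tlt; lra.
have m0t1 : m0 < t1 by rewrite -tlt; lra.
have t1m1 : t1 < m1 by rewrite -tlt; lra.
have m1t2 : m1 < t2 by rewrite -tlt; lra.
have incr s t : t0 <= s -> s < t -> t <= t1 -> x s < x t.
  move=> h1 st h2; apply: (derive_gt0_lt Dx st) => v /andP[sv vt].
  apply: (proj1 (TR v)).
  by have ? : th t0 < th v; [|have ? : th v < th t1]; rewrite ?tlt; try lra;
    apply/andP; split; lra.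
have decr s t : t1 <= s -> s < t -> t <= t2 -> x t < x s.
  move=> h1 st h2; rewrite -ltrN2.
  apply: (derive_gt0_lt (fun v => dN (Dx v)) st) => v /andP[sv vt].
  rewrite oppr_gt0; apply: (proj1 (proj2 (TR v))).
  by have ? : th t1 < th v; [|have ? : th v < th t2]; rewrite ?tlt; try lra;
    apply/andP; split; lra.
have yincr s t : m0 <= s -> s < t -> t <= m1 -> y s < y t.
  move=> h1 st h2; apply: (derive_gt0_lt Dy st) => v /andP[sv vt].
  apply: (proj2 (proj2 (TR v))).
  by have ? : th m0 < th v; [|have ? : th v < th m1]; rewrite ?tlt; try lra;
    apply/andP; split; lra.
(* At [q] both branches are within a quarter turn of the rightmost point, where the
   ordinate increases along the curve. *)
pose q := Num.max u (Num.max (x m0) (x m1)).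
have uq : u <= q by rewrite /q le_max lexx.
have m0q : x m0 <= q by rewrite /q !le_max lexx !orbT.
have m1q : x m1 <= q by rewrite /q !le_max lexx !orbT.
have qt1 : q < x t1.
  by rewrite /q !gt_max u1 incr ?decr//; exact: ltW.
have strict v : u <= v <= q -> x (sigma0 v) = v /\ x (sigma1 v) = v /\
    sigma0 v < t1 < sigma1 v /\ sigma1 v < sigma0 v + L.
  move=> /andP[v1 v2].
  have [|/andP[a1 a2] a3] := A0 v; first by apply/andP; split; lra.
  have [|/andP[b1 b2] b3] := A1 v; first by apply/andP; split; lra.
  have h1 : sigma0 v < t1.
    by rewrite lt_neqAle a2 andbT; apply/eqP => E; rewrite E in a3; lra.
  have h2 : t1 < sigma1 v.
    by rewrite lt_neqAle b1 andbT; apply/eqP => E; rewrite -E in b3; lra.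
  do 3 split=> //; first by rewrite h1 h2.
  case: tL => [|[tE xu]]; first by lra.
  have : sigma1 v < t2.
    by rewrite lt_neqAle b2 andbT; apply/eqP => E; rewrite E in b3; lra.
  by lra.
rewrite (@no_crossing sigma0 sigma1 u q cs0 cs1 _ u q) ?lexx ?uq//; last first.
  by move=> v /strict [-> [-> [/andP[? ?] ?]]]; do 2 split=> //; apply/andP; split; lra.
have [|x0 [x1 [/andP[l0 l1] lL]]] := strict q; first by rewrite uq lexx.
apply: (@lt_trans _ _ (y t1)); apply: yincr => //; try lra.
- rewrite leNgt; apply/negP => h.
  have [|/andP[a1 a2] a3] := A0 q; first by apply/andP; split; lra.
  by have := incr _ _ a1 h (ltW m0t1); lra.
- rewrite leNgt; apply/negP => h.
  have [|/andP[b1 b2] b3] := A1 q; first by apply/andP; split; lra.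
  by have := decr _ _ (ltW t1m1) h b2; lra.
Qed.

End Facts.

(** Rotation by a straight angle turns [right_cap] into its counterpart at a
    leftmost point. *)
Lemma left_cap x y th r w L c psi t1 t2 t3 sigma1 sigma2 :
  turning_loop x y th r w L c ->
  cos psi = 0 -> sin psi = -1 ->
  th t1 = psi - pi -> th t2 = psi -> th t3 = psi + pi ->
  arc_inverse x t1 t2 (x t2) (x t1) sigma1 ->
  arc_inverse x t2 t3 (x t2) (x t3) sigma2 ->
  forall u, u <= x t1 -> u <= x t3 -> x t2 < u ->
  t3 < t1 + L ->
  y (sigma2 u) < y (sigma1 u).
Proof.
move=> H c0 s1 E1 E2 E3 A1 A2 u u1 u3 u2 tL.
have H' := turning_loop_opp H.
rewrite -ltrN2 -[u]opprK.
apply: (right_cap H' (phi := psi + pi) _ _ _ _ _ (arc_inverse_opp A1)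
  (arc_inverse_opp A2)); rewrite ?cosDpi ?sinDpi ?c0 ?s1 ?oppr0 ?opprK ?E1 ?E2 ?E3;
  by [ring | lra | left].
Qed.

Section RotationNumber.
Context x y th r w L c (H : turning_loop x y th r w L c).

Lemma lower_arc psi t0 t1 : cos psi = 0 -> sin psi = -1 ->
  th t0 = psi -> th t1 = psi + pi ->
  t0 < t1 /\ exists sigma, arc_inverse x t0 t1 (x t0) (x t1) sigma.
Proof.
move=> c0 s1 E0 E1; have pi0 : 0 < pi :> R by exact: pi_gt0.
have t01 : t0 < t1 by rewrite -(turning_th_lt H); lra.
split=> //; apply: (arc_inverse_incr t01 (tl_dx H)) => s /andP[s0 s1'].
rewrite mulr_gt0 ?(tl_r H)//.
rewrite -(turning_th_lt H) in s0; rewrite -(turning_th_lt H) in s1'.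
have -> : th s = psi + (th s - psi) by ring.
rewrite cosD c0 s1 mul0r sub0r mulN1r opprK sin_gt0_pi//.
by apply/andP; split; lra.
Qed.

Lemma upper_arc phi t1 t2 : cos phi = 0 -> sin phi = 1 ->
  th t1 = phi -> th t2 = phi + pi ->
  t1 < t2 /\ exists sigma, arc_inverse x t1 t2 (x t2) (x t1) sigma.
Proof.
move=> c0 s1 E0 E1; have pi0 : 0 < pi :> R by exact: pi_gt0.
have t01 : t1 < t2 by rewrite -(turning_th_lt H); lra.
split=> //; apply: (arc_inverse_decr t01 (tl_dx H)) => s /andP[s0 s1'].
rewrite pmulr_rlt0 ?(tl_r H)//.
rewrite -(turning_th_lt H) in s0; rewrite -(turning_th_lt H) in s1'.
have -> : th s = phi + (th s - phi) by ring.
rewrite cosD c0 s1 mul0r sub0r mul1r oppr_lt0 sin_gt0_pi//.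
by apply/andP; split; lra.
Qed.

(** If the curve starts to spiral inwards, it is trapped: the second lower
    branch lies between the first lower and the first upper one, so it stops
    earlier on the right, and the second upper branch, which cannot cross the
    first, stops earlier on the left. *)
Lemma spiral_step psi t0 t2 t4 : cos psi = 0 -> sin psi = -1 ->
  4 * pi <= c -> th t0 = psi -> th t2 = psi + 2 * pi -> th t4 = psi + 4 * pi ->
  x t0 <= x t2 -> x t2 < x t4.
Proof.
move=> c0 s1 c4 E0 E2 E4 x02; have pi0 : 0 < pi :> R by exact: pi_gt0.
have [t1 E1] := turning_th_surj H (psi + pi).
have [t3 E3] := turning_th_surj H (psi + 3 * pi).
have cp : cos (psi + pi) = 0 by rewrite cosDpi c0 oppr0.
have sp : sin (psi + pi) = 1 by rewrite sinDpi s1 opprK.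
have cpp : cos (psi + 2 * pi) = 0.
  have -> : psi + 2 * pi = psi + pi + pi by ring.
  by rewrite cosDpi cp oppr0.
have spp : sin (psi + 2 * pi) = -1.
  have -> : psi + 2 * pi = psi + pi + pi by ring.
  by rewrite sinDpi sp.
have cppp : cos (psi + 3 * pi) = 0.
  have -> : psi + 3 * pi = psi + 2 * pi + pi by ring.
  by rewrite cosDpi cpp oppr0.
have sppp : sin (psi + 3 * pi) = 1.
  have -> : psi + 3 * pi = psi + 2 * pi + pi by ring.
  by rewrite sinDpi spp opprK.
have [t01 [g0 G0]] := lower_arc c0 s1 E0 E1.
have [t12 [g1 G1]] : t1 < t2 /\ exists g, arc_inverse x t1 t2 (x t2) (x t1) g.
  by apply: (upper_arc cp sp E1); lra.
have [t23 [g2 G2]] : t2 < t3 /\ exists g, arc_inverse x t2 t3 (x t2) (x t3) g.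
  by apply: (lower_arc cpp spp E2); lra.
have [t34 [g3 G3]] : t3 < t4 /\ exists g, arc_inverse x t3 t4 (x t4) (x t3) g.
  by apply: (upper_arc cppp sppp E3); lra.
have t4L : t4 <= t0 + L.
  by rewrite -(turning_th_le H) (tl_th H); lra.
have cap01 u : x t2 <= u -> u < x t1 -> y (g0 u) < y (g1 u).
  move=> u2 u1; apply: (right_cap H cp sp _ E1 _ G0 G1) => //; lra.
have cap12 u : x t2 < u -> u <= x t1 -> u <= x t3 -> y (g2 u) < y (g1 u).
  by move=> ? ? ?; apply: (left_cap H cpp spp _ E2 _ G1 G2) => //; lra.
have cap23 u : x t2 <= u -> x t4 <= u -> u < x t3 -> y (g2 u) < y (g3 u).
  move=> ? ? ?; apply: (right_cap H cppp sppp _ E3 _ G2 G3) => //; lra.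
case: G0 => cg0 A0 B0; case: G1 => cg1 A1 B1.
case: G2 => cg2 A2 B2; case: G3 => cg3 A3 B3.
have [_ g0t1] := B0 t1 (introT andP (conj (ltW t01) (lexx _))).
have [/andP[_ x21'] g1t1] := B1 t1 (introT andP (conj (lexx _) (ltW t12))).
have [_ g1t2] := B1 t2 (introT andP (conj (ltW t12) (lexx _))).
have [_ g2t2] := B2 t2 (introT andP (conj (lexx _) (ltW t23))).
have [/andP[x23' _] g2t3] := B2 t3 (introT andP (conj (ltW t23) (lexx _))).
have [_ g3t3] := B3 t3 (introT andP (conj (lexx _) (ltW t34))).
have neq s t : s < t < s + L -> x s = x t -> y s = y t -> False.
  by move=> st xE yE; apply: (tl_simple H st).
have x21 : x t2 < x t1.
  have [/andP[h _] _] := B1 t1 (introT andP (conj (lexx _) (ltW t12))).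
  rewrite lt_neqAle h andbT; apply/eqP => E.
  by move: g1t2; rewrite E g1t1; lra.
have x23 : x t2 < x t3.
  rewrite lt_neqAle x23' andbT; apply/eqP => E.
  by move: g2t2; rewrite E g2t3; lra.
rewrite ltNge; apply/negP => x42.
(* Otherwise the second lower branch, below the first upper one, would end below
   the first lower one. *)
have b10 : x t3 < x t1.
  rewrite ltNge; apply/negP => b01.
  have below : (y (g0 (x t2)) < y (g2 (x t2))) = (y (g0 (x t1)) < y (g2 (x t1))).
    apply: (no_crossing H (p := x t2) (q := x t1)) => //; try by apply/andP; split; lra.
    move=> u /andP[u2 u1].
    have [|/andP[? ?] ?] := A0 u; first by apply/andP; split; lra.
    have [|/andP[? ?] ?] := A2 u; first by apply/andP; split; lra.
    by do 2 split=> //; apply/andP; split; lra.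
  have := cap01 (x t2) (lexx _) x21; rewrite g1t2 -[X in _ < y X]g2t2 below g0t1.
  by have := cap12 (x t1) x21 (lexx _) b01; rewrite g1t1; lra.
(* The second upper branch starts below the first one, and it would reach the
   abscissa of the leftmost point [t2] above it. *)
have := cap23 (x t2) (lexx _) x42 x23; rewrite g2t2 -[X in y X < _]g1t2.
rewrite (@no_crossing _ _ _ _ _ _ _ H g1 g3 (x t2) (x t3) cg1 cg3 _ _ (x t3)).
- by rewrite g3t3 -[X in _ < y X]g2t3; have := cap12 _ x23 (ltW b10) (lexx _); lra.
- move=> u /andP[u2 u1].
  have [|/andP[? ?] ?] := A1 u; first by apply/andP; split; lra.
  have [|/andP[? ?] ?] := A3 u; first by apply/andP; split; lra.
  by do 2 split=> //; apply/andP; split; lra.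
- by rewrite lexx ltW.
- by rewrite lexx ltW.
Qed.

(** If the angle gained two turns or more, consider the abscissas of the successive
    leftmost points, which depend periodically on their rank. Once one of
    them does not exceed the next one, they increase from there on by [spiral_step];
    otherwise they all decrease. Both contradict the periodicity. *)
Lemma rotation_number : c = 2 * pi.
Proof.
have pi0 : 0 < pi :> R by exact: pi_gt0.
have c0 := turning_c_gt0 H.
have [n cE] := cos_eq1_mod2pi (ltW c0) (turning_cos_c H).
case: n cE => [|[|n]] cE; [by move: c0; rewrite cE mul0r ltxx|by rewrite cE; ring|].
exfalso.
have c4 : 4 * pi <= c.
  by rewrite cE -!natr1; have : 0 <= n%:R :> R by []; nra.
have [tau tauP] := choice (turning_th_surj H).
pose ps (j : nat) : R := - (pi / 2) + j%:R * (2 * pi).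
have psS j : ps j.+1 = ps j + 2 * pi by rewrite /ps -natr1; ring.
have cps j : cos (ps j) = 0 /\ sin (ps j) = -1.
  elim: j => [|j [IHc IHs]].
    by rewrite /ps mul0r addr0 cosN sinN cos_pihalf sin_pihalf.
  have -> : ps j.+1 = ps j + pi + pi by rewrite psS; ring.
  by rewrite !cosDpi !sinDpi !opprK.
pose a j := x (tau (ps j)).
have step j : a j <= a j.+1 -> a j.+1 < a j.+2.
  have [cj sj] := cps j.
  move=> aj; apply: (spiral_step cj sj c4 _ _ _ aj); rewrite tauP ?psS//; ring.
have per j : a (j + n.+2)%N = a j.
  rewrite /a; suff -> : tau (ps (j + n.+2)%N) = tau (ps j) + L by rewrite (tl_x H).
  apply: (turning_th_inj H); rewrite (tl_th H) !tauP cE /ps natrD.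
  by ring.
have [[j aj]|none] := pselect (exists j, a j <= a j.+1).
  have mono m : a (j + m)%N <= a (j + m).+1.
    by elim: m => [|m IH]; rewrite ?addn0// addnS; exact: ltW (step _ IH).
  have up m : a j < a (j + m.+2)%N.
    elim: m => [|m IH]; last by rewrite addnS (lt_le_trans IH)// mono.
    by rewrite !addnS addn0 (le_lt_trans aj)// step.
  by have := up n; rewrite per ltxx.
have down m : a m.+1 < a 0%N.
  elim: m => [|m IH]; last apply: lt_trans IH.
    by rewrite ltNge; apply/negP => h; apply: none; exists 0%N.
  by rewrite ltNge; apply/negP => h; apply: none; exists m.+1.
by have := down n.+1; rewrite -[n.+2]add0n per ltxx.
Qed.

End RotationNumber.
End Turning.

(** * The domain between two graphs, and its hyperbolic area *)

Section Region.
Context {R : realType}.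
Implicit Types (a b u v : R) (f g F : R -> R) (C D S : set (R * R)).

Definition between a b f g : set (R * R) :=
  [set p | a < p.1 < b /\ f p.1 < p.2 < g p.1].

(** Off the boundary [C], the open set [D] coincides with its closure. *)
Lemma connected_avoiding_boundary D C S : open D -> closure D `\` D = C ->
  connected S -> S `&` C = set0 -> S `&` D !=set0 -> S `<=` D.
Proof.
move=> oD bD cS SC SD.
have <- : S `&` D = S; last exact: subIsetr.
apply: cS => //; first by exists D.
exists (closure D); first exact: closed_closure.
apply/seteqP; split=> p [Sp Dp]; split=> //; first exact: subset_closure.
apply: contrapT => nD; have : (S `&` C) p by split=> //; rewrite -bD.
by rewrite SC.
Qed.

Lemma connected_graph (I : set R) (f g : R -> R) : is_interval I ->
  continuous f -> continuous g -> connected [set (f t, g t) | t in I].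
Proof.
move=> iI cf cg; apply: connected_continuous_connected.
  exact/connected_intervalP.
apply: continuous_subspaceT => t.
exact: (cvg_pair (cf t) (cg t)).
Qed.

Lemma vertical_sub D C u (I : set R) v : open D -> closure D `\` D = C ->
  is_interval I -> (forall w, I w -> ~ C (u, w)) -> I v -> D (u, v) ->
  forall w, I w -> D (u, w).
Proof.
move=> oD bD iI IC Iv Dv w Iw.
have cid : continuous (fun t : R => t) by move=> t; exact: cvg_id.
have cS := connected_graph iI (@cst_continuous R R u) cid.
apply: (connected_avoiding_boundary oD bD cS); last by exists w.
- by apply/seteqP; split=> // p [[t It <-]] /(IC t It).
- by exists (u, v); split=> //; exists v.
Qed.

Lemma ordinate_bounded D : D !=set0 -> compact (closure D) ->
  exists M, forall p, D p -> p.2 <= M.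
Proof.
move=> [p0 Dp0] cD.
have [||c _ cmax] := @compact_EVT_max _ R snd (closure D) _ cD.
- by exists p0; exact: subset_closure.
- by apply: continuous_subspaceT => p; exact: cvg_snd.
by exists c.2 => p Dp; apply: cmax; rewrite inE; exact: subset_closure.
Qed.

(** A half-line that avoids [C] does not meet [D]: a downward one leaves the
    half-plane, an upward one is unbounded. So [D] lies between the graphs, which
    cover [C]. Conversely the vertical segments between the graphs avoid [C], and so
    does the curve of their midpoints, which links them together; since [D] is not
    empty, it contains all of them. *)
Lemma domain_between D C a b f g :
  D `<=` H2 -> open D -> compact (closure D) -> closure D `\` D = C -> C !=set0 ->
  a < b -> continuous f -> continuous g ->
  f a = g a -> f b = g b -> (forall u, a < u < b -> f u < g u) ->
  (forall p, C p -> a <= p.1 <= b /\ (p.2 = f p.1 \/ p.2 = g p.1)) ->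
  D = between a b f g.
Proof.
move=> DH oD cD bD C0 ab cf cg fga fgb fgs CP.
have fg u : a <= u <= b -> f u <= g u.
  rewrite !le_eqVlt => /andP[/predU1P[<- _|au /predU1P[->|ub]]]; rewrite -?le_eqVlt.
  - by rewrite fga.
  - by rewrite fgb.
  - by rewrite ltW// fgs// au ub.
have D0 : D !=set0.
  apply/set0P/eqP => D0; move: bD C0; rewrite D0 closure0 setD0 => <- [].
  by [].
have [M MP] := ordinate_bounded D0 cD.
have up u v : D (u, v) -> (forall w, v <= w -> ~ C (u, w)) -> False.
  move=> Duv nC.
  have iI : is_interval [set w : R | v <= w].
    by move=> w1 w2 /= h1 h2 w /andP[h3 _]; exact: le_trans h3.
  have vM := MP _ Duv; rewrite /= in vM.
  have := vertical_sub oD bD iI nC (lexx v) Duv (w := M + 1).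
  by move=> /(_ ltac:(rewrite /=; lra))/MP /=; lra.
have down u v : D (u, v) -> (forall w, w <= v -> ~ C (u, w)) -> False.
  move=> Duv nC.
  have iI : is_interval [set w : R | w <= v].
    by move=> w1 w2 /= h1 h2 w /andP[_ h3]; exact: le_trans h2.
  have v0 := DH _ Duv; rewrite /H2 /= in v0.
  have := vertical_sub oD bD iI nC (lexx v) Duv (w := 0).
  by move=> /(_ (ltW v0))/DH; rewrite /H2 /= ltxx.
have sub : D `<=` between a b f g.
  move=> [u v] Duv; have nCuv : ~ C (u, v) by rewrite -bD => -[].
  have uab : a <= u <= b.
    apply: contrapT => nuab; apply: (up u v Duv) => w _ /CP /= [].
    by [].
  have vf : f u < v.
    rewrite ltNge; apply/negP => vf; apply: (down u v Duv) => w wv Cuw.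
    have [_ /= wE] := CP _ Cuw.
    have : w = v by have := fg u uab; case: wE; lra.
    by move=> wv'; apply: nCuv; rewrite -wv'.
  have vg : v < g u.
    rewrite ltNge; apply/negP => vg; apply: (up u v Duv) => w wv Cuw.
    have [_ /= wE] := CP _ Cuw.
    have : w = v by have := fg u uab; case: wE; lra.
    by move=> wv'; apply: nCuv; rewrite -wv'.
  split=> /=; last by rewrite vf vg.
  move/andP: uab => [au ub].
  rewrite !lt_neqAle au ub !andbT; apply/andP; split; apply/eqP => E.
    by move: vf vg; rewrite -E fga; lra.
  by move: vf vg; rewrite E fgb; lra.
apply/seteqP; split=> //.
have slice u v w : a < u < b -> f u < v < g u -> f u < w < g u -> D (u, v) -> D (u, w).
  move=> uab vin win Duv.
  have iI := @is_interval_oo _ (f u) (g u).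
  apply: (vertical_sub oD bD iI _ vin Duv) => // t /= /andP[t1 t2] /CP /= [_].
  by case; lra.
pose m u := (f u + g u) / 2.
have mP u : a < u < b -> f u < m u < g u.
  by move=> /fgs h; rewrite /m; apply/andP; split; lra.
have cm : continuous m.
  move=> u; rewrite /m; apply: (@cvgM R R (nbhs u) _ (fun u => f u + g u)).
    by apply: (@cvgD R R^o); [exact: cf | exact: cg].
  exact: cvg_cst.
have midD u : a < u < b -> D (u, m u).
  move=> uab.
  have cid : continuous (fun t : R => t) by move=> t; exact: cvg_id.
  have cS := connected_graph (@is_interval_oo _ a b) cid cm.
  apply: (connected_avoiding_boundary oD bD cS); last by exists u.
    apply/seteqP; split=> // p [[t /= tab <-]] /CP /= [_].
    by have := mP t tab; case/andP=> ? ?; case; lra.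
  have [[u0 v0] Dp] := D0; have [/= u0ab v0in] := sub _ Dp.
  exists (u0, m u0); split; first by exists u0.
  exact: (slice u0 v0 _ u0ab v0in (mP u0 u0ab) Dp).
move=> [u v] [/= uab vin].
exact: (slice u (m u) v uab (mP u uab) vin (midD u uab)).
Qed.

Lemma measurable_between a b f g : continuous f -> continuous g ->
  measurable (between a b f g).
Proof.
move=> cf cg.
have mfst : measurable_fun setT (fun p : R * R => p.1) by exact: measurable_fst.
have msnd : measurable_fun setT (fun p : R * R => p.2) by exact: measurable_snd.
have mc (h : R -> R) : continuous h -> measurable_fun setT (fun p : R * R => h p.1).
  move=> ch; apply: (measurableT_comp (f := h)) => //.
  exact: continuous_measurable_fun.
have -> : between a b f g =
  ((fun p : R * R => p.1) @^-1` `]a, b[) `&`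
  ((fun p : R * R => p.2 - f p.1) @^-1` `]0, +oo[) `&`
  ((fun p : R * R => g p.1 - p.2) @^-1` `]0, +oo[).
  apply/seteqP; split=> -[u v]; rewrite /between /= !in_itv /= !andbT !subr_gt0.
    by move=> [-> /andP[-> ->]].
  by move=> [[-> ->] ->].
apply: measurableI; first apply: measurableI.
- by rewrite -[X in measurable X]setTI; exact: mfst.
- rewrite -[X in measurable X]setTI.
  by apply: (measurable_funB msnd (mc f cf)) => //.
- rewrite -[X in measurable X]setTI.
  by apply: (measurable_funB (mc g cg) msnd) => //.
Qed.

(** Integrating first along the verticals, where [- 1 / y] is a primitive of the
    density of the hyperbolic area. *)
Lemma area_between a b f g F : a < b -> continuous f -> continuous g ->
  (forall u, 0 < f u) -> (forall u, 0 < g u) -> (forall u, a < u < b -> f u < g u) ->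
  continuous F ->
  (forall u : R, a < u < b -> is_derive u 1 F ((f u)^-1 - (g u)^-1)) ->
  hyp_area (between a b f g) = (F b - F a)%:E.
Proof.
move=> ab cf cg f0 g0 fg cF DF.
have mB := measurable_between a b cf cg.
rewrite /hyp_area integral_mkcond fubini_tonelli1; last 2 first.
- apply/(measurable_restrictT _ mB).
  apply/measurable_EFinP.
  apply: (eq_measurable_fun (fun p : R * R => p.2 `^ (1 *- 2))).
    move=> [u v]; rewrite inE => -[/= _ /andP[v0 _]].
    by rewrite powR_invn// ltW// (lt_trans _ v0).
  have mpow : measurable_fun setT (fun p : R * R => p.2 `^ (1 *- 2)).
    exact: (measurableT_comp (measurable_powR (1 *- 2 : R)) measurable_snd).
  exact: (measurable_funTS mpow).
- move=> p; rewrite patchE; case: ifP => // _.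
  by rewrite lee_fin invr_ge0 sqr_ge0.
have inner u : fubini_F lebesgue_measure
    ((fun p : R * R => (p.2 ^- 2)%:E) \_ (between a b f g)) u =
    ((fun u => ((f u)^-1 - (g u)^-1)%:E) \_ `]a, b[) u.
  rewrite /fubini_F [RHS]patchE; case: ifPn => [|nuab].
    rewrite inE /= in_itv /= => uab.
    (* On the interval of integration [ym] is the identity; as it stays away from
       [0], its inverse is continuous everywhere. *)
    pose ym (v : R) := Num.max (f u) v.
    have ym0 v : 0 < ym v by rewrite /ym lt_max f0.
    have cym : continuous ym.
      by move=> v; apply: continuous_max; [exact: cvg_cst | exact: cvg_id].
    transitivity (\int[lebesgue_measure]_(v in `]f u, g u[) (ym v ^- 2)%:E)%E.
      rewrite [RHS]integral_mkcond; apply: eq_integral => v _.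
      rewrite !patchE.
      have -> : ((u, v) \in between a b f g) = (v \in [set` `]f u, g u[]).
        apply/idP/idP; rewrite !inE /between /= in_itv /=; first by case.
        by move=> ->.
      case: ifP => //; rewrite inE/= in_itv/= => /andP[h _].
      by rewrite /ym max_r// ltW.
    have c1 : continuous (fun v => ym v ^- 2).
      apply: continuous_inv_pos => [v|v]; last by rewrite exprn_gt0.
      exact: (@cvgM R R (nbhs v) _ ym ym _ _ (cym v) (cym v)).
    have c2 : continuous (fun v => - (ym v)^-1).
      by move=> v; apply: cvgN; exact: continuous_inv_pos.
    have Dm (v : R) : f u < v < g u -> is_derive v 1 (fun v => - (ym v)^-1) (ym v ^- 2).
      move=> /andP[v1 v2].
      have vn0 : v != 0 by rewrite gt_eqF// (lt_trans _ v1).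
      have D : is_derive v 1 (fun v : R => - v^-1) (ym v ^- 2).
        apply: (is_derive_eq (dN (dV vn0 (dI v)))).
        by rewrite /ym max_r ?ltW//; field.
      apply: near_eq_is_derive D.
      near=> w.
      rewrite /ym max_r// ltW//; near: w; exact: lt_nbhsr.
    rewrite (ftc_open (fg u uab) c1 c2 Dm) /ym max_r ?max_l//.
      by congr EFin; ring.
    by rewrite ltW// fg.
  rewrite integral0_eq// => v _; rewrite patchE; case: ifP => //.
  rewrite inE => -[/= uab _]; move: nuab; rewrite notin_setE /= in_itv /=.
  by move/(_ uab).
transitivity (\int[lebesgue_measure]_u
    ((fun u => ((f u)^-1 - (g u)^-1)%:E) \_ `]a, b[) u)%E.
  by apply: eq_integral => u _; exact: inner.
rewrite -integral_mkcond; apply: (ftc_open ab _ cF DF).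
move=> u; apply: (@cvgB R R^o); [exact: continuous_inv_pos|exact: continuous_inv_pos].
Unshelve. all: end_near.
Qed.

End Region.

Section LoopArea.
Context {R : realType} (x y th w Phi : R -> R) (L : R).
Context (H : turning_loop x y th y w L (2 * pi))
  (DPhi : forall s : R, is_derive s 1 Phi (cos (th s))).

(** For a unit-speed loop of rotation number one, the two arcs between the leftmost
    and the rightmost point are graphs, and [D] is the domain between them. The
    area is then the integral of [dx / y] along the loop; as [dx / y] is
    [cos th ds], this is the increment of [Phi] in one period. *)
Lemma loop_area (D : set (R * R)) (A : R) :
  D `<=` H2 -> open D -> compact (closure D) ->
  closure D `\` D = range (fun s => (x s, y s)) -> hyp_area D = A%:E ->
  forall s, Phi (s + L) = Phi s + A.
Proof.
have pi0 : 0 < pi :> R by exact: pi_gt0.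
have Lp := tl_period H.
have cosL s : cos (th (s + L)) = cos (th s).
  have -> : th (s + L) = th s + pi + pi by rewrite (tl_th H); ring.
  by rewrite !cosDpi opprK.
have PhiL := periodic_increment DPhi cosL.
have c0 : cos (- (pi / 2)) = 0 :> R by rewrite cosN cos_pihalf.
have s0 : sin (- (pi / 2)) = -1 :> R by rewrite sinN sin_pihalf.
have c1 : cos (- (pi / 2) + pi) = 0 :> R by rewrite cosDpi c0 oppr0.
have s1 : sin (- (pi / 2) + pi) = 1 :> R by rewrite sinDpi s0 opprK.
have [t0 E0] := turning_th_surj H (- (pi / 2)).
have [t1 E1] := turning_th_surj H (- (pi / 2) + pi).
have E2 : th (t0 + L) = - (pi / 2) + pi + pi by rewrite (tl_th H) E0; ring.
have [t01 [g0 G0]] := lower_arc H c0 s0 E0 E1.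
have [t12 [g1 G1]] := upper_arc H c1 s1 E1 E2.
rewrite (tl_x H) in G1.
have x01 : x t0 < x t1.
  case: G0 => _ _ B; have [/andP[_ h] B0] := B t0 ltac:(by rewrite lexx ltW).
  have [_ B1] := B t1 ltac:(by rewrite lexx ltW).
  by rewrite lt_neqAle h andbT; apply/eqP => E; move: B0; rewrite E B1; lra.
have lt01 u : x t0 < u < x t1 -> y (g0 u) < y (g1 u).
  move=> /andP[u0 u1]; have G1' := G1; rewrite -(tl_x H t0) in G1'.
  apply: (right_cap H c1 s1 _ E1 E2 G0 G1'); rewrite ?(tl_x H) ?(ltW u0)//.
    by rewrite E0; ring.
  by right.
have turnP := turning_right H c1 s1.
have cy := turning_y_cont H.
have cPhi : continuous Phi by move=> s; exact: is_derive_cont (DPhi s).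
have D0 u : x t0 < u < x t1 -> is_derive u 1 (fun u => Phi (g0 u)) (y (g0 u))^-1.
  move=> /andP[u0 u1]; case: (G0) => _ A0 B0.
  have [/andP[h1 h2] xE] := A0 u ltac:(by rewrite !ltW).
  have h3 : t0 < g0 u by rewrite lt_neqAle h1 andbT; apply/eqP => E; rewrite -E in xE; lra.
  have h4 : g0 u < t1 by rewrite lt_neqAle h2 andbT; apply/eqP => E; rewrite E in xE; lra.
  have pos : 0 < y (g0 u) * cos (th (g0 u)).
    apply: (proj1 (turnP _)).
    rewrite -(turning_th_lt H) in h3; rewrite -(turning_th_lt H) in h4.
    by apply/andP; split; lra.
  have := derive_arc_inverse (tl_dx H) G0 (s := g0 u) ltac:(by rewrite h3 h4)
    ltac:(by rewrite gt_eqF).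
  rewrite xE => Dg; apply: (is_derive_eq (dcomp (DPhi _) Dg)).
  have /norP[yn cn] : ~~ ((y (g0 u) == 0) || (cos (th (g0 u)) == 0)).
    by rewrite -mulf_eq0 gt_eqF.
  by field; rewrite yn cn.
have D1 u : x t0 < u < x t1 -> is_derive u 1 (fun u => Phi (g1 u)) (y (g1 u))^-1.
  move=> /andP[u0 u1]; case: (G1) => _ A1 B1.
  have [/andP[h1 h2] xE] := A1 u ltac:(by rewrite !ltW).
  have h3 : t1 < g1 u by rewrite lt_neqAle h1 andbT; apply/eqP => E; rewrite -E in xE; lra.
  have h4 : g1 u < t0 + L.
    rewrite lt_neqAle h2 andbT; apply/eqP => E; rewrite E (tl_x H) in xE; lra.
  have neg : y (g1 u) * cos (th (g1 u)) < 0.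
    apply: (proj1 (proj2 (turnP _))).
    rewrite -(turning_th_lt H) in h3; rewrite -(turning_th_lt H) in h4.
    by apply/andP; split; lra.
  have := derive_arc_inverse (tl_dx H) G1 (s := g1 u) ltac:(by rewrite h3 h4)
    ltac:(by rewrite lt_eqF).
  rewrite xE => Dg; apply: (is_derive_eq (dcomp (DPhi _) Dg)).
  have /norP[yn cn] : ~~ ((y (g1 u) == 0) || (cos (th (g1 u)) == 0)).
    by rewrite -mulf_eq0 lt_eqF.
  by field; rewrite yn cn.
case: (G0) => cg0 A0 B0; case: (G1) => cg1 A1 B1.
have comp (f g : R -> R) : continuous f -> continuous g -> continuous (fun u => f (g u)).
  by move=> cf cg u; apply: continuous_comp; [exact: cg | exact: cf].
have [_ g00] := B0 t0 ltac:(by rewrite lexx ltW).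
have [_ g01] := B0 t1 ltac:(by rewrite lexx ltW).
have [_ g11] := B1 t1 ltac:(by rewrite lexx ltW).
have [_ g12] := B1 (t0 + L) ltac:(by rewrite lexx ltW).
rewrite (tl_x H) in g12.
move=> DH oD cD bD DA.
have DE : D = between (x t0) (x t1) (fun u => y (g0 u)) (fun u => y (g1 u)).
  apply: (domain_between DH oD cD bD _ x01 (comp _ _ cy cg0) (comp _ _ cy cg1)) => //.
  - by exists (x 0, y 0); exists 0.
  - by rewrite g00 g12 (tl_y H).
  - by rewrite g01 g11.
  - move=> p [s _ <-] /=.
    have [u|d [/andP[d1 d2] dE]] := @periodic_shift _ _ (fun s => (x s, y s)) L t0 s Lp.
      by rewrite (tl_x H) (tl_y H).
    have [<- <-] := dE s.
    have [st|ts] := leP (s + d) t1.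
      by have [-> ->] := B0 (s + d) ltac:(by rewrite d1 st); split=> //; left.
    by have [-> ->] := B1 (s + d) ltac:(by rewrite !ltW); split=> //; right.
have cF : continuous (fun u => Phi (g0 u) - Phi (g1 u)).
  by move=> u; apply: (@cvgB R R^o); exact: comp.
have DF u : x t0 < u < x t1 ->
    is_derive u 1 (fun u => Phi (g0 u) - Phi (g1 u)) ((y (g0 u))^-1 - (y (g1 u))^-1).
  by move=> uab; exact: dD (D0 u uab) (dN (D1 u uab)).
have area := area_between x01 (comp _ _ cy cg0) (comp _ _ cy cg1)
  (fun u => tl_r H (g0 u)) (fun u => tl_r H (g1 u)) lt01 cF DF.
move: DA; rewrite DE area g00 g01 g11 g12 => -[<-] s.
transitivity (Phi s + (Phi (s + L) - Phi s)); first by ring.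
by rewrite (PhiL s t0); ring.
Qed.

End LoopArea.

(** * Points turning once around the projective line *)

Section Projective.
Context {R : realType}.
Implicit Types (p dp h dh f df : R -> R) (s t u v L : R).

Section Turn.
Context p dp h dh L.
Context (Dp : forall s : R, is_derive s 1 p (dp s))
  (Dh : forall s : R, is_derive s 1 h (dh s)) (dh0 : forall s, 0 < dh s)
  (pL : forall s, p (s + L) = - p s) (hL : forall s, h (s + L) = h s + pi)
  (W : forall s, 0 < dp s * sin (h s) - p s * (cos (h s) * dh s)).

Let hlt s t : s < t -> h s < h t.
Proof. by move=> st; exact: (derive_gt0_lt Dh st). Qed.

(** While [sin h] keeps its sign, the affine coordinate [p / sin h] is
    increasing. *)
Lemma wedge_same_side s t : s < t -> h t < h s + pi ->
  0 < sin (h s) * sin (h t) -> 0 < p t * sin (h s) - sin (h t) * p s.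
Proof.
move=> st ht same.
have side v : s <= v <= t -> 0 < sin (h s) * sin (h v).
  rewrite !le_eqVlt => /andP[/predU1P[<- _|sv /predU1P[->//|vt]]].
    rewrite -expr2 exprn_even_gt0//=; apply/eqP => E; move: same.
    by rewrite E mul0r ltxx.
  have := hlt sv; have := hlt vt => h1 h2.
  have s1 : 0 < sin (h v - h s) by apply: sin_gt0_pi; apply/andP; split; lra.
  have s2 : 0 < sin (h t - h v) by apply: sin_gt0_pi; apply/andP; split; lra.
  have s3 : 0 < sin (h t - h s) by apply: sin_gt0_pi; apply/andP; split; lra.
  rewrite -(pmulr_lgt0 _ s3).
  have -> : sin (h s) * sin (h v) * sin (h t - h s) =
      sin (h s) ^+ 2 * sin (h t - h v) + sin (h s) * sin (h t) * sin (h v - h s).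
    by rewrite !sinB; ring.
  by apply: ltr_wpDl; [rewrite mulr_ge0 ?sqr_ge0 ?ltW | rewrite mulr_gt0].
have nz v : s <= v <= t -> sin (h v) != 0.
  by move=> /side; apply: contraTneq => ->; rewrite mulr0 ltxx.
pose q v := p v / sin (h v).
pose dq v := (dp v * sin (h v) - p v * (cos (h v) * dh v)) / sin (h v) ^+ 2.
have Dq v : s <= v <= t -> is_derive v 1 q (dq v).
  move=> /nz n0; have Ds := dsin (Dh v).
  by apply: (is_derive_eq (dM (Dp v) (dV n0 Ds))); rewrite /dq; field.
have : q s < q t.
  apply: (derive_itv_gt0_lt st Dq) => v /andP[sv vt].
  rewrite divr_gt0 ?W// exprn_even_gt0//= nz//; apply/andP; split; exact: ltW.
have sl : s <= s <= t by rewrite lexx ltW.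
have tl : s <= t <= t by rewrite lexx ltW.
rewrite -subr_gt0 -(pmulr_lgt0 _ same) /q.
suff -> : (p t / sin (h t) - p s / sin (h s)) * (sin (h s) * sin (h t)) =
  p t * sin (h s) - sin (h t) * p s by [].
by field; rewrite !nz.
Qed.

(** The point with homogeneous coordinates [(p, sin h)] always moves in the same
    direction and makes a single turn per period, so it does not come back to its
    position at time [s] before the period is over. If [sin h] has changed sign
    between [s] and [t], the affine coordinate is compared between [t] and
    [s + L]. *)
Lemma wedge_gt0 s t : s < t < s + L -> 0 < p t * sin (h s) - sin (h t) * p s.
Proof.
move=> /andP[st tL].
have h1 := hlt st; have h2 := hlt tL; rewrite hL in h2.
have sd : 0 < sin (h t - h s) by apply: sin_gt0_pi; apply/andP; split; lra.
have tE : sin (h t) = sin (h s) * cos (h t - h s) + cos (h s) * sin (h t - h s).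
  by rewrite -sinD; congr sin; ring.
have sE : sin (h s) = sin (h t) * cos (h t - h s) - cos (h t) * sin (h t - h s).
  by rewrite -sinB; congr sin; ring.
have [s0|s0] := eqVneq (sin (h s)) 0.
  have := W s; rewrite tE s0 !mul0r !mulr0 !add0r mulrA oppr_gt0.
  rewrite pmulr_llt0// => pc.
  by rewrite oppr_gt0 mulrAC pmulr_llt0// mulrC.
have [t0|t0] := eqVneq (sin (h t)) 0.
  have := W t; rewrite sE t0 !mul0r !mulr0 !sub0r subr0 mulrA oppr_gt0.
  rewrite pmulr_llt0// => pc.
  by rewrite mulrN oppr_gt0 mulrA pmulr_llt0.
have [same|] := ltP 0 (sin (h s) * sin (h t)); first exact: wedge_same_side.
rewrite le_eqVlt mulf_eq0 (negbTE s0) (negbTE t0)/= => opp.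
have hst : h (s + L) < h t + pi by rewrite hL; lra.
have := wedge_same_side tL hst.
rewrite hL sinDpi pL mulrN oppr_gt0 mulrC => /(_ opp).
by rewrite !mulNr opprK addrC mulrC [p s * _]mulrC.
Qed.

Lemma wedge_lt0 s t : s - L < t < s -> p t * sin (h s) - sin (h t) * p s < 0.
Proof.
move=> /andP[t1 t2]; have := @wedge_gt0 s (t + L).
rewrite pL hL sinDpi !mulNr opprK => Q.
by have := Q ltac:(apply/andP; split; lra); lra.
Qed.

End Turn.
End Projective.

(** * Four points of average curvature *)

(** For a unit-speed loop with tangent angle [th = 2 h], the oriented geodesic that
    is normal to the loop at time [s] has the ideal end points
    [x - y cos h / sin h] and [x + y sin h / cos h] on the real line; [(P, sin h)]
    and [(Q, cos h)] are their homogeneous coordinates. Then [front s1 s] vanishes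
    when the normals at [s1] and [s] have the same end on the inner side, and
    [back s2 s] when those at [s2] and [s] have the same end on the other side. *)
Section FourPoints.
Context {R : realType} (x y th k K : R -> R) (L kappa : R).
Context (H : turning_loop x y th y (fun s => k s - cos (th s)) L (2 * pi))
  (k1 : forall s, 1 < k s) (ck : continuous k)
  (DK : forall s : R, is_derive s 1 K (k s))
  (KL : forall s, K (s + L) = K s + kappa * L).

Let h s := th s / 2.
Let P s := x s * sin (h s) - y s * cos (h s).
Let Q s := x s * cos (h s) + y s * sin (h s).
Let front s1 s := P s * sin (h s1) - sin (h s) * P s1.
Let back s2 s := Q s * cos (h s2) - cos (h s) * Q s2.

Let y0 s : 0 < y s. Proof. exact: tl_r H s. Qed.
Let yn0 s : y s != 0. Proof. by rewrite gt_eqF. Qed.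
Let Dx := tl_dx H.
Let Dy := tl_dy H.
Let Dth := tl_dth H.

Let dh s := (k s - cos (th s)) / 2.

Let Dh (s : R) : is_derive s 1 h (dh s).
Proof.
rewrite /h; eapply is_derive_eq; first by repeat derive_step.
by rewrite /dh mulr0 addr0.
Qed.

Let hL s : h (s + L) = h s + pi.
Proof. by rewrite /h (tl_th H); field. Qed.

Let dh0 s : 0 < dh s.
Proof. by rewrite divr_gt0// (tl_w H). Qed.

Let thE s : th s = h s + h s.
Proof. by rewrite /h; field. Qed.

Let cosE s : cos (th s) = cos (h s) ^+ 2 - sin (h s) ^+ 2.
Proof. by rewrite thE cosD !expr2. Qed.

Let sinE s : sin (th s) = 2 * sin (h s) * cos (h s).
Proof. by rewrite thE sinD; ring. Qed.

Let PL s : P (s + L) = - P s.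
Proof. by rewrite /P hL sinDpi cosDpi (tl_x H) (tl_y H); ring. Qed.
Let QL s : Q (s + L) = - Q s.
Proof. by rewrite /Q hL sinDpi cosDpi (tl_x H) (tl_y H); ring. Qed.

(** The wedge product of the derivative of [(P, sin h)] with [(P, sin h)] is
    [y (k - 1) / 2]: the inner end moves in a fixed direction because [k > 1]. *)
Lemma front_sign s1 s : (s1 < s < s1 + L -> 0 < front s1 s) /\
  (s1 - L < s < s1 -> front s1 s < 0).
Proof.
pose dP s := y s * cos (th s) * sin (h s) + x s * (cos (h s) * dh s) -
   (y s * sin (th s) * cos (h s) + y s * (- sin (h s) * dh s)).
have DP (u : R) : is_derive u 1 P (dP u).
  have Dhu := Dh u.
  by rewrite /P; eapply is_derive_eq; [repeat derive_step | rewrite /dP; ring].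
have W u : 0 < dP u * sin (h u) - P u * (cos (h u) * dh u).
  have -> : dP u * sin (h u) - P u * (cos (h u) * dh u) = y u * (k u - 1) / 2.
    have E := cos2Dsin2 (h u).
    have -> : y u * (k u - 1) / 2 =
       y u * (k u * (cos (h u) ^+ 2 + sin (h u) ^+ 2)
         - (cos (h u) ^+ 2 + sin (h u) ^+ 2) ^+ 2) / 2.
      by rewrite E; field.
    by rewrite /dP /P /dh sinE cosE; field.
  by rewrite divr_gt0// mulr_gt0// subr_gt0.
split; [exact: (wedge_gt0 DP Dh dh0 PL hL W)|exact: (wedge_lt0 DP Dh dh0 PL hL W)].
Qed.

(** Here the wedge product is [y (k + 1) / 2], so the outer end moves in the same
    direction as the inner one. *)
Lemma back_sign s2 s : (s2 < s < s2 + L -> 0 < back s2 s) /\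
  (s2 - L < s < s2 -> back s2 s < 0).
Proof.
pose g u := h u + pi / 2.
have sg u : sin (g u) = cos (h u) by rewrite /g sinDpihalf.
have cg u : cos (g u) = - sin (h u) by rewrite /g cosDpihalf.
pose dQ s := y s * cos (th s) * cos (h s) + x s * (- sin (h s) * dh s) +
   (y s * sin (th s) * sin (h s) + y s * (cos (h s) * dh s)).
have DQ (u : R) : is_derive u 1 Q (dQ u).
  have Dhu := Dh u.
  by rewrite /Q; eapply is_derive_eq; [repeat derive_step | rewrite /dQ; ring].
have Dg (u : R) : is_derive u 1 g (dh u).
  have Dhu := Dh u.
  by rewrite /g; eapply is_derive_eq; [repeat derive_step | rewrite addr0].
have gL u : g (u + L) = g u + pi by rewrite /g hL; ring.
have W u : 0 < dQ u * sin (g u) - Q u * (cos (g u) * dh u).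
  rewrite sg cg.
  have -> : dQ u * cos (h u) - Q u * (- sin (h u) * dh u) = y u * (k u + 1) / 2.
    have E := cos2Dsin2 (h u).
    have -> : y u * (k u + 1) / 2 =
       y u * (k u * (cos (h u) ^+ 2 + sin (h u) ^+ 2)
         + (cos (h u) ^+ 2 + sin (h u) ^+ 2) ^+ 2) / 2.
      by rewrite E; field.
    by rewrite /dQ /Q /dh sinE cosE; field.
  by rewrite divr_gt0// mulr_gt0// ltr_wpDl// ltW// (lt_trans ltr01).
have := wedge_gt0 DQ Dg dh0 QL gL W (s := s2) (t := s).
have := wedge_lt0 DQ Dg dh0 QL gL W (s := s2) (t := s).
by rewrite !sg.
Qed.

(** The functions [front s1 * back s2 / y] are combinations of [1] and of the
    derivatives along the loop of the functions [1 / y], [x / y] and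
    [(x ^ 2 + y ^ 2) / y], which are the coordinates in the hyperboloid model. In
    that model the unit tangent and normal vectors [T] and [N] satisfy
    [N' = - k T], so that [k T] integrates to zero, as [T] does. Hence [k - kappa]
    is orthogonal to [1] and to the coordinates of [T]. *)
Lemma orthogonality s1 s2 : exists G : R -> R,
  (forall s : R, is_derive s 1 G ((k s - kappa) * (front s1 s * back s2 s / y s))) /\
  (forall s, G (s + L) = G s).
Proof.
(* [m1], [m2] and [m3] are the coordinates of [N + kappa * X], where [X] is the
   position. *)
pose a := cos (h s2) * sin (h s1) / 2.
pose b1 := sin (h s1) * Q s2 / 2.
pose b2 := P s1 * cos (h s2) / 2.
pose d := P s1 * Q s2 / 2.
pose m1 s := - cos (th s) / y s + kappa * (y s)^-1.
pose m2 s := - sin (th s) - x s * cos (th s) / y s + kappa * (x s / y s).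
pose m3 s := - 2 * x s * sin (th s) - x s * x s * cos (th s) / y s + y s * cos (th s)
  + kappa * (x s * x s / y s + y s).
exists (fun s => a * m3 s - (b1 + b2) * m2 s + d * m1 s + (b1 - b2) * (K s - s * kappa)).
split; last first.
  move=> s; rewrite KL /m1 /m2 /m3 (tl_x H) (tl_y H) (tl_th H).
  have -> : th s + 2 * pi = th s + pi + pi by ring.
  by rewrite !cosDpi !sinDpi !opprK; ring.
move=> s; have yn := yn0 s.
eapply is_derive_eq; first by rewrite /m1 /m2 /m3; repeat derive_step.
set f := front s1 s * back s2 s / y s.
have -> : f =
   2 * a * ((x s ^+ 2 - y s ^+ 2) / (2 * y s) * sin (th s) - x s * cos (th s))
   - 2 * b1 * (x s * sin (th s) / (2 * y s) - cos (th s) / 2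
       - (cos (h s) ^+ 2 + sin (h s) ^+ 2) / 2)
   - 2 * b2 * (x s * sin (th s) / (2 * y s) - cos (th s) / 2
       + (cos (h s) ^+ 2 + sin (h s) ^+ 2) / 2)
   + 2 * d * (sin (th s) / (2 * y s)).
  rewrite /f /front /back sinE cosE /a /b1 /b2 /d.
  by rewrite {1}/P {1}/Q; field.
rewrite cos2Dsin2 /=.
by field.
Qed.

Let phi s := k s - kappa.

Let cphi : continuous phi.
Proof. by move=> s; apply: (@continuousB R R^o); [exact: ck | exact: cst_continuous]. Qed.

Let phi_sign u v : (forall s, u < s < v -> phi s != 0) ->
  (forall s, u < s < v -> 0 < phi s) \/ (forall s, u < s < v -> phi s < 0).
Proof.
move=> nz; have [uv|vu] := ltP u v; last first.
  by left=> s /andP[us sv]; have := lt_trans us sv; rewrite ltNge vu.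
have cN : continuous (fun s => - phi s).
  by move=> s; apply: (@continuousN R R^o); exact: cphi.
have m : u < (u + v) / 2 < v by apply/andP; split; lra.
have iI := @is_interval_oo _ u v.
have [pm|pm] := ltP 0 (phi ((u + v) / 2)).
  by left; exact: (pos_on_interval cphi iI nz m pm).
right=> s sin; rewrite -oppr_gt0.
apply: (pos_on_interval cN iI _ m _ sin) => [t tin|].
  by rewrite oppr_eq0; exact: nz.
by rewrite oppr_gt0 lt_neqAle pm andbT nz.
Qed.

(** A function whose derivative is positive except at finitely many points takes
    distinct values at the ends of a period. *)
Let no_growth (G g : R -> R) (z a b : R) : z < a -> a <= b -> b < z + L ->
  (forall s : R, is_derive s 1 G (g s)) -> G (z + L) = G z ->
  ((forall s, z < s < a -> 0 < g s) /\ (forall s, a < s < b -> 0 < g s) /\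
   (forall s, b < s < z + L -> 0 < g s)) -> False.
Proof.
move=> za ab bL DG GL [g1 [g2 g3]].
have := derive_gt0_lt DG za g1; have := derive_gt0_le DG ab g2.
by have := derive_gt0_lt DG bL g3; lra.
Qed.

Let no_decay (G g : R -> R) (z a b : R) : z < a -> a <= b -> b < z + L ->
  (forall s : R, is_derive s 1 G (g s)) -> G (z + L) = G z ->
  ((forall s, z < s < a -> g s < 0) /\ (forall s, a < s < b -> g s < 0) /\
   (forall s, b < s < z + L -> g s < 0)) -> False.
Proof.
move=> za ab bL DG GL [g1 [g2 g3]].
apply: (no_growth za ab bL (fun s => dN (DG s))); first by rewrite GL.
by split; [move=> s /g1 | split=> s; [move/g2 | move/g3]]; rewrite oppr_gt0.
Qed.

(** If [k - kappa] had at most three zeros [z], [a] and [b] in a period, it would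
    have at most two sign changes, and some function of [orthogonality], or the
    constant [1], would have the same ones: their product would have a constant sign
    and a vanishing integral. *)
Let three_arcs (z a b : R) : z < a -> a <= b -> b < z + L ->
  (forall s, z < s < a -> phi s != 0) -> (forall s, a < s < b -> phi s != 0) ->
  (forall s, b < s < z + L -> phi s != 0) -> False.
Proof.
move=> za ab bL n1 n2 n3.
have DM (s : R) : is_derive s 1 (fun s => K s - s * kappa) (phi s).
  by eapply is_derive_eq; [repeat derive_step | rewrite /phi; ring].
have ML : K (z + L) - (z + L) * kappa = K z - z * kappa by rewrite KL; ring.
have [G1 [D1 G1L]] := orthogonality z a.
have [G2 [D2 G2L]] := orthogonality z b.
have [G3 [D3 G3L]] := orthogonality a b.
have quot u v w : (0 < u * v -> 0 < u * v / y w) /\ (u * v < 0 -> u * v / y w < 0).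
  by split=> uv; rewrite ?divr_gt0// pmulr_llt0// invr_gt0.
have pos12 s1 s2 s : s1 < s < s1 + L -> s2 < s < s2 + L ->
    0 < front s1 s * back s2 s / y s.
  move=> h1 h2; apply: (quot _ _ s).1; rewrite mulr_gt0//.
    exact: (front_sign _ _).1.
  exact: (back_sign _ _).1.
have neg12 s1 s2 s : s1 < s < s1 + L -> s2 - L < s < s2 ->
    front s1 s * back s2 s / y s < 0.
  move=> h1 h2; apply: (quot _ _ s).2; rewrite pmulr_rlt0.
    exact: (back_sign _ _).2.
  exact: (front_sign _ _).1.
have pos21 s1 s2 s : s1 - L < s < s1 -> s2 - L < s < s2 ->
    0 < front s1 s * back s2 s / y s.
  move=> h1 h2; apply: (quot _ _ s).1; rewrite nmulr_rgt0.
    exact: (back_sign _ _).2.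
  exact: (front_sign _ _).2.
have Lp := tl_period H.
have [e1|e1] := phi_sign n1; have [e2|e2] := phi_sign n2; have [e3|e3] := phi_sign n3.
- by apply: (no_growth za ab bL DM ML).
- apply: (no_decay za ab bL D2 (G2L z)).
  split; [|split] => s sin; have /andP[l1 l2] := sin.
  + by rewrite pmulr_rlt0 ?e1//; apply: neg12; apply/andP; split; lra.
  + by rewrite pmulr_rlt0 ?e2//; apply: neg12; apply/andP; split; lra.
  + by rewrite nmulr_rlt0 ?e3//; apply: pos12; apply/andP; split; lra.
- apply: (no_growth za ab bL D3 (G3L z)).
  split; [|split] => s sin; have /andP[l1 l2] := sin.
  + by rewrite pmulr_rgt0 ?e1//; apply: pos21; apply/andP; split; lra.
  + by rewrite nmulr_rgt0 ?e2//; apply: neg12; apply/andP; split; lra.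
  + by rewrite pmulr_rgt0 ?e3//; apply: pos12; apply/andP; split; lra.
- apply: (no_decay za ab bL D1 (G1L z)).
  split; [|split] => s sin; have /andP[l1 l2] := sin.
  + by rewrite pmulr_rlt0 ?e1//; apply: neg12; apply/andP; split; lra.
  + by rewrite nmulr_rlt0 ?e2//; apply: pos12; apply/andP; split; lra.
  + by rewrite nmulr_rlt0 ?e3//; apply: pos12; apply/andP; split; lra.
- apply: (no_growth za ab bL D1 (G1L z)).
  split; [|split] => s sin; have /andP[l1 l2] := sin.
  + by rewrite nmulr_rgt0 ?e1//; apply: neg12; apply/andP; split; lra.
  + by rewrite pmulr_rgt0 ?e2//; apply: pos12; apply/andP; split; lra.
  + by rewrite pmulr_rgt0 ?e3//; apply: pos12; apply/andP; split; lra.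
- apply: (no_decay za ab bL D3 (G3L z)).
  split; [|split] => s sin; have /andP[l1 l2] := sin.
  + by rewrite nmulr_rlt0 ?e1//; apply: pos21; apply/andP; split; lra.
  + by rewrite pmulr_rlt0 ?e2//; apply: neg12; apply/andP; split; lra.
  + by rewrite nmulr_rlt0 ?e3//; apply: pos12; apply/andP; split; lra.
- apply: (no_growth za ab bL D2 (G2L z)).
  split; [|split] => s sin; have /andP[l1 l2] := sin.
  + by rewrite nmulr_rgt0 ?e1//; apply: neg12; apply/andP; split; lra.
  + by rewrite nmulr_rgt0 ?e2//; apply: neg12; apply/andP; split; lra.
  + by rewrite pmulr_rgt0 ?e3//; apply: pos12; apply/andP; split; lra.
- by apply: (no_decay za ab bL DM ML).
Qed.

(** Given fewer than four zeros, repeating some of them or adding other points makes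
    three arcs without zeros. *)
Lemma four_points : exists z1 z2 z3 z4,
  [/\ z1 < z2, z2 < z3, z3 < z4 & z4 < z1 + L] /\
  [/\ k z1 = kappa, k z2 = kappa, k z3 = kappa & k z4 = kappa].
Proof.
have Lp := tl_period H.
have phi0 s : (phi s == 0) = (k s == kappa) by rewrite subr_eq0.
apply: contrapT => none.
have {}none z1 z2 z3 z4 : z1 < z2 -> z2 < z3 -> z3 < z4 -> z4 < z1 + L ->
    phi z1 = 0 -> phi z2 = 0 -> phi z3 = 0 -> phi z4 = 0 -> False.
  move=> ? ? ? ? /subr0_eq ? /subr0_eq ? /subr0_eq ? /subr0_eq ?.
  by apply: none; exists z1, z2, z3, z4.
have [z z0] : exists z, phi z = 0.
  apply: contrapT => nz.
  have nz' s : phi s != 0 by apply/eqP => s0; apply: nz; exists s.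
  by apply: (@three_arcs 0 (L / 2) (L / 2)) => // *; lra.
have outside a b : z < a -> a <= b -> b < z + L ->
    (exists s, [/\ z < s, s < z + L, s != a, s != b & phi s = 0]).
  move=> za ab bL; apply: contrapT => ns.
  have nz s : z < s -> s < z + L -> s != a -> s != b -> phi s != 0.
    by move=> ? ? ? ?; apply/eqP => s0; apply: ns; exists s; split.
  have neq (u v : R) : u < v \/ v < u -> u != v.
    by case=> uv; [rewrite lt_eqF | rewrite gt_eqF].
  by apply: (three_arcs za ab bL) => s /andP[s1 s2]; apply: nz; try apply: neq; lra.
have [|||c [zc cL _ _ c0]] := outside (z + L / 2) (z + L / 2); [lra|by []|lra|].
have [|||d [zd dL dc _ d0]] := outside c c; [by []|by []|by []|].
have [a [b [ab [a0 b0] [za bL]]]] : exists a b,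
    [/\ a < b, phi a = 0 /\ phi b = 0 & z < a /\ b < z + L].
  by case: (ltgtP c d) dc => // cd _; [exists c, d|exists d, c].
have [e [ze eL ea eb e0]] := outside a b za (ltW ab) bL.
case: (ltgtP e a) ea => // ea _; first exact: (none z e a b).
case: (ltgtP e b) eb => // eb _; first exact: (none z a e b).
exact: (none z a b e).
Qed.

End FourPoints.

(** * Horocyclically convex curves *)

(** Gauss-Bonnet and the four points for a loop that is traversed with the inner
    side on its left. The geodesic curvature is [th' + cos th], so [th + Phi] is one
    of its primitives. *)
Lemma horoconvex_loop {R : realType} (x y th k Phi : R -> R) (L c A : R)
    (D : set (R * R)) :
  turning_loop x y th y (fun s => k s - cos (th s)) L c ->
  (forall s, 1 < k s) -> continuous k ->
  (forall s : R, is_derive s 1 Phi (cos (th s))) ->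
  D `<=` H2 -> open D -> compact (closure D) ->
  closure D `\` D = range (fun s => (x s, y s)) -> hyp_area D = A%:E ->
  (forall s, th (s + L) + Phi (s + L) = th s + Phi s + (2 * pi + A)) /\
  exists z1 z2 z3 z4,
    [/\ z1 < z2, z2 < z3, z3 < z4 & z4 < z1 + L] /\
    [/\ k z1 = (2 * pi + A) / L, k z2 = (2 * pi + A) / L,
        k z3 = (2 * pi + A) / L & k z4 = (2 * pi + A) / L].
Proof.
move=> H k1 ck DPhi DH oD cD bD DA.
have cE := rotation_number H; rewrite {}cE in H.
have PhiL := loop_area H DPhi DH oD cD bD DA.
have KL s : th (s + L) + Phi (s + L) = th s + Phi s + (2 * pi + A).
  by rewrite (tl_th H) PhiL; ring.
split=> //.
have Dth := tl_dth H.
have DK (s : R) : is_derive s 1 (fun s => th s + Phi s) (k s).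
  by apply: (is_derive_eq (dD (Dth s) (DPhi s))); ring.
apply: (four_points H k1 ck DK) => s.
by rewrite KL divfK// gt_eqF// (tl_period H).
Qed.

Section Curve.
Context {R : realType}.
Implicit Types (gamma : R -> R * R) (D : set (R * R)) (L s : R).

Lemma smooth_derive (f : R -> R) n (s : R) : smooth f ->
  is_derive s 1 (derive1n n f) (derive1n n.+1 f s).
Proof. by move=> sf; rewrite derive1nS derive1E; apply: DeriveDef. Qed.

(** The curvature with respect to the left normal, which depends continuously
    on the point, whereas the inner normal is chosen point by point. *)
Definition left_curvature gamma s : R :=
  hyp_metric (gamma s) (cov_derive gamma (velocity gamma) s) (left_normal gamma s).

Lemma hyp_metric_oppr (p v w : R * R) :
  hyp_metric p v (- w.1, - w.2) = - hyp_metric p v w.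
Proof. by rewrite /hyp_metric /= !mulrN -opprD mulNr. Qed.

Lemma geodesic_curvature_left gamma D s :
  geodesic_curvature gamma D s = left_curvature gamma s \/
  geodesic_curvature gamma D s = - left_curvature gamma s.
Proof.
rewrite /geodesic_curvature /left_curvature /inner_normal.
by case: ifP => _; [left | right; rewrite hyp_metric_oppr].
Qed.

Lemma constant_sign (k : R -> R) : continuous k -> (forall s, k s != 0) ->
  0 < k 0 -> forall s, 0 < k s.
Proof.
move=> ck nz k0 s.
exact: (pos_on_interval ck (@interval_is_interval _ `]-oo, +oo[) (fun u _ => nz u) _ k0).
Qed.

End Curve.

Theorem mainTheorem2 (R : realType) (gamma : R -> R * R) (L A : R)
    (D : set (R * R))
    (hgamma : simple_closed_curve gamma L)
    (hD : bounds_domain gamma D)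
    (hA : hyp_area D = A%:E)
    (hconvex : horocyclically_convex gamma D) :
  mean_curvature gamma D L = (2 * pi + A) / L /\
  exists s : 'I_4 -> R,
    injective (gamma \o s) /\
    forall i : 'I_4, geodesic_curvature gamma D (s i) = mean_curvature gamma D L.
Proof.
case: hgamma => L0 [smx smy] gH unit [gL ginj].
case: hD => DH oD _ cD bD.
pose x := fst \o gamma; pose y := snd \o gamma.
have y0 s : 0 < y s by exact: gH.
have yn s : y s != 0 by rewrite gt_eqF.
pose X n := derive1n n x; pose Y n := derive1n n y.
have DX n (s : R) : is_derive s 1 (X n) (X n.+1 s) by exact: (smooth_derive n s smx).
have DY n (s : R) : is_derive s 1 (Y n) (Y n.+1 s) by exact: (smooth_derive n s smy).
have Dx (s : R) : is_derive s 1 x (X 1%N s) by exact: (DX 0%N).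
have Dy (s : R) : is_derive s 1 y (Y 1%N s) by exact: (DY 0%N).
have xL s : x (s + L) = x s by rewrite /x /= gL.
have yL s : y (s + L) = y s by rewrite /y /= gL.
have coords s t : x s = x t -> y s = y t -> gamma s = gamma t.
  by rewrite /x /y /=; case: (gamma s) (gamma t) => ? ? [? ?] /= -> ->.
have simple s t : s < t < s + L -> gamma s <> gamma t.
  move=> /andP[st tL] E.
  have [d [/andP[d1 d2] dE]] := periodic_shift 0 s L0 gL.
  rewrite -dE -[RHS]dE in E; rewrite add0r in d2.
  have [tdL|Ltd] := ltP (t + d) L.
    by have := ginj (s + d) (t + d) ltac:(lra) ltac:(lra) E; lra.
  have E' : gamma (s + d) = gamma (t + d - L) by rewrite E -[RHS]gL subrK.
  by have := ginj (s + d) (t + d - L) ltac:(lra) ltac:(lra) E'; lra.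
have speed s : X 1%N s ^+ 2 + Y 1%N s ^+ 2 = y s ^+ 2.
  have u1 : (X 1%N s * X 1%N s + Y 1%N s * Y 1%N s) / y s ^+ 2 = 1 := unit s.
  by rewrite -[RHS]mul1r -u1 divfK ?expf_neq0// !expr2.
(* [(c, d)] is the Euclidean unit tangent vector. *)
pose c s := X 1%N s / y s; pose d s := Y 1%N s / y s.
pose dc s := (X 2%N s - X 1%N s * Y 1%N s / y s) / y s.
pose dd s := (Y 2%N s - Y 1%N s * Y 1%N s / y s) / y s.
have Dc (s : R) : is_derive s 1 c (dc s).
  have D1 := DX 1%N s; have yns := yn s.
  rewrite /c; eapply is_derive_eq; first by repeat derive_step.
  by rewrite /dc; field.
have Dd (s : R) : is_derive s 1 d (dd s).
  have D1 := DY 1%N s; have yns := yn s.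
  rewrite /d; eapply is_derive_eq; first by repeat derive_step.
  by rewrite /dd; field.
have cdc : continuous dc.
  move=> s; have D1 := DX 1%N s; have D2 := DX 2%N s; have D3 := DY 1%N s; have yns := yn s.
  by eapply is_derive_cont; rewrite /dc; repeat derive_step.
have cdd : continuous dd.
  move=> s; have D1 := DY 1%N s; have D2 := DY 2%N s; have yns := yn s.
  by eapply is_derive_cont; rewrite /dd; repeat derive_step.
have cd1 s : c s ^+ 2 + d s ^+ 2 = 1.
  by rewrite /c /d !expr_div_n -mulrDl speed divff// expf_neq0.
have [th thP] := angle_lift Dc Dd cdc cdd cd1.
pose om s := c s * dd s - d s * dc s.
have kE s : left_curvature gamma s = om s + c s.
  rewrite /left_curvature /hyp_metric /cov_derive /left_normal /=.
  have -> : derive1 (fst \o velocity gamma) s = X 2%N s by rewrite /X derive1nS.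
  have -> : derive1 (snd \o velocity gamma) s = Y 2%N s by rewrite /Y derive1nS.
  rewrite -[derive1 _ s]/(X 1%N s) -[derive1 (snd \o gamma) s]/(Y 1%N s).
  rewrite -[(gamma s).2]/(y s).
  rewrite /om /c /d /dc /dd.
  have := speed s; have := yn s; move: (X 2%N s) (Y 2%N s) (X 1%N s) (Y 1%N s) (y s).
  move=> x2 y2 x1 y1 v vn sp.
  set w := (W in _ = W + _).
  (* The Christoffel symbols contribute the cosine of the tangent angle, by unit
     speed. *)
  have -> : w + x1 / v = w + x1 * (x1 ^+ 2 + y1 ^+ 2) / v ^+ 3 by rewrite sp; field.
  by rewrite /w; field.
have Dth (s : R) : is_derive s 1 th (om s) by have [] := thP s.
have cE s : c s = cos (th s) by have [] := thP s.
have cont_c : continuous c by move=> s; exact: is_derive_cont (Dc s).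
have cont_d : continuous d by move=> s; exact: is_derive_cont (Dd s).
have com : continuous om.
  rewrite /om => s; apply: (@cvgB R R^o).
    exact: cvgM (cont_c s) (cdd s).
  exact: cvgM (cont_d s) (cdc s).
have csum : continuous (fun s => om s + c s).
  by move=> s; apply: (@cvgD R R^o); [exact: com | exact: cont_c].
have ck : continuous (left_curvature gamma).
  by rewrite (_ : left_curvature gamma = fun s => om s + c s)//; apply/funext.
have XL n s : X n (s + L) = X n s.
  by elim: n s => [//|n IH] s; exact: (periodic_derive (DX n)).
have YL n s : Y n (s + L) = Y n s.
  by elim: n s => [//|n IH] s; exact: (periodic_derive (DY n)).
have omL s : om (s + L) = om s by rewrite /om /c /d /dc /dd !XL !YL yL.
have thL s : th (s + L) = th s + (th L - th 0).
  by have := periodic_increment Dth omL s 0; rewrite add0r; lra.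
have Dx' (s : R) : is_derive s 1 x (y s * cos (th s)).
  by rewrite -cE /c mulrC divfK.
have Dy' (s : R) : is_derive s 1 y (y s * sin (th s)).
  by have [_ <- _] := thP s; rewrite /d mulrC divfK.
have [Phi DPhi'] := antiderivative cont_c.
have DPhi (s : R) : is_derive s 1 Phi (cos (th s)) by rewrite -cE.
pose k := left_curvature gamma.
have k_gt1 s : 1 < k s \/ 1 < - k s.
  by have := hconvex s; case: (geodesic_curvature_left gamma D s) => ->; [left | right].
have knz s : k s != 0.
  by apply/eqP => ks; case: (k_gt1 s); rewrite ks; lra.
have bD' : closure D `\` D = range (fun s => (x s, y s)).
  rewrite bD; have -> // : (fun s => (x s, y s)) = gamma.
  by apply/funext => s; rewrite /x /y /= -surjective_pairing.
(* It is enough to exhibit a primitive of the curvature with the increment of the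
   Gauss-Bonnet formula and four points on less than one period. *)
have conclude (K : R -> R) :
    (forall s : R, is_derive s 1 K (geodesic_curvature gamma D s)) ->
    continuous (geodesic_curvature gamma D) ->
    K L - K 0 = 2 * pi + A ->
    (exists z1 z2 z3 z4, [/\ z1 < z2, z2 < z3, z3 < z4 & z4 < z1 + L] /\
      [/\ geodesic_curvature gamma D z1 = (2 * pi + A) / L,
          geodesic_curvature gamma D z2 = (2 * pi + A) / L,
          geodesic_curvature gamma D z3 = (2 * pi + A) / L &
          geodesic_curvature gamma D z4 = (2 * pi + A) / L]) ->
    mean_curvature gamma D L = (2 * pi + A) / L /\
    exists s : 'I_4 -> R, injective (gamma \o s) /\
      forall i : 'I_4, geodesic_curvature gamma D (s i) = mean_curvature gamma D L.
  move=> DK cG KL [z1 [z2 [z3 [z4 [[z12 z23 z34 z41] [k1 k2 k3 k4]]]]]].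
  have meanE : mean_curvature gamma D L = (2 * pi + A) / L.
    have cK : continuous K by move=> s; exact: is_derive_cont (DK s).
    rewrite /mean_curvature /Rintegral (ftc_closed L0 cG cK (fun u _ => DK u)) /=.
    by rewrite KL mulrC.
  split=> //; rewrite meanE.
  pose zs := [:: z1; z2; z3; z4].
  exists (fun i : 'I_4 => nth 0 zs i); split; last first.
    by move=> [[|[|[|[|//]]]] ?].
  have lt (i j : 'I_4) : (i < j)%N -> nth 0 zs i < nth 0 zs j < nth 0 zs i + L.
    clear -z12 z23 z34 z41 L0.
    by case: i j => [[|[|[|[|//]]]] ?] [[|[|[|[|//]]]] ?] //= _; apply/andP; split; lra.
  move=> i j /= E; apply: val_inj => /=.
  case: (ltngtP (i : nat) j) => // /lt /simple ne; first by case: (ne E).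
  by case: (ne (esym E)).
(* The left curvature has no zero, so it has a constant sign. If it is negative, the
   curve is traversed backwards. *)
have [kpos|] := ltP 0 (k 0).
  have kp s : 0 < k s := constant_sign ck knz kpos s.
  have gE : geodesic_curvature gamma D = k.
    apply/funext => s; case: (geodesic_curvature_left gamma D s) => // E.
    by have := hconvex s; have := kp s; rewrite E /k; lra.
  have k1 s : 1 < k s by case: (k_gt1 s) => //; have := kp s; lra.
  have H : turning_loop x y th y (fun s => k s - cos (th s)) L (th L - th 0).
    split=> //.
    - by move=> s; apply: (is_derive_eq (Dth s)); rewrite /k kE cE addrK.
    - by move=> s; rewrite subr_gt0 (le_lt_trans (cos_le1 _) (k1 s)).
    - move=> s t /simple + [xE yE]; apply.
      exact: coords.
  have [KL four] := horoconvex_loop H k1 ck DPhi DH oD cD bD' hA.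
  apply: (conclude (fun s => th s + Phi s)); rewrite ?gE //.
  - by move=> s; apply: (is_derive_eq (dD (Dth s) (DPhi s))); rewrite /k kE cE.
  - by have := KL 0; rewrite add0r; lra.
rewrite le_eqVlt (negbTE (knz 0)) /= => kneg.
have kn s : k s < 0.
  have cN : continuous (fun s => - k s).
    by move=> u; apply: (@cvgN R R^o); exact: ck.
  have nzN u : - k u != 0 by rewrite oppr_eq0.
  have kneg' : 0 < - k 0 by rewrite oppr_gt0.
  by have := constant_sign cN nzN kneg' s; rewrite oppr_gt0.
have gE : geodesic_curvature gamma D = fun s => - k s.
  apply/funext => s; case: (geodesic_curvature_left gamma D s) => // E.
  by have := hconvex s; have := kn s; rewrite E /k; lra.
have DN (s : R) : is_derive s 1 (fun s : R => - s) (-1) by exact: dN (dI s).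
pose k' s := - k (- s).
have k1 s : 1 < k' s by rewrite /k'; case: (k_gt1 (- s)) => //; have := kn (- s); lra.
have perN (f : R -> R) : (forall s, f (s + L) = f s) -> forall s, f (- (s + L)) = f (- s).
  by move=> fL s; rewrite -fL; congr f; ring.
have H : turning_loop (fun s => x (- s)) (fun s => y (- s)) (fun s => th (- s) + pi)
    (fun s => y (- s)) (fun s => k' s - cos (th (- s) + pi)) L (th 0 - th L).
  split=> //.
  - move=> s; apply: (is_derive_eq (dcomp (Dx' _) (DN s))).
    by rewrite cosDpi; ring.
  - move=> s; apply: (is_derive_eq (dcomp (Dy' _) (DN s))).
    by rewrite sinDpi; ring.
  - move=> s; apply: (is_derive_eq (dD (dcomp (Dth _) (DN s)) (dC pi s))).
    by rewrite /k' /k kE cE cosDpi; ring.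
  - by move=> s; rewrite subr_gt0 (le_lt_trans (cos_le1 _) (k1 s)).
  - exact: perN.
  - exact: perN.
  - by move=> s; rewrite -[in RHS](subrK L (- s)) thL opprD; ring.
  - move=> s t /andP[st tL] [xE yE]; apply: (@simple (- t) (- s)); first lra.
    exact: coords.
have DPhi2 (s : R) : is_derive s 1 (fun s => Phi (- s)) (cos (th (- s) + pi)).
  by apply: (is_derive_eq (dcomp (DPhi _) (DN s))); rewrite cosDpi; ring.
have ck' : continuous k'.
  move=> s; apply: (@cvgN R R^o); apply: continuous_comp; last exact: ck.
  exact: oppr_continuous.
have bD2 : closure D `\` D = range (fun s => (x (- s), y (- s))).
  rewrite bD'; apply/seteqP; split=> _ [s _ <-]; last by exists (- s).
  by exists (- s); rewrite ?opprK.
have [KL [z1 [z2 [z3 [z4 [[z12 z23 z34 z41] [k1' k2' k3' k4']]]]]]] :=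
  horoconvex_loop H k1 ck' DPhi2 DH oD cD bD2 hA.
apply: (conclude (fun s => - (th s + Phi s))); rewrite ?gE.
- by move=> s; apply: (is_derive_eq (dN (dD (Dth s) (DPhi s)))); rewrite /k kE cE.
- by move=> s; apply: (@cvgN R R^o); exact: ck.
- by have := KL (- L); rewrite addNr oppr0 opprK; lra.
- by exists (- z4), (- z3), (- z2), (- z1); split; split=> //; lra.
Qed.
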